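(* Let $W$ be an affine Weyl group, $\mathring W$ the associated finite Weyl group, and $\pi_0,\dots,\pi_n$ the projections associated to $\mathrm{cl}(\alpha_0),\dots,\mathrm{cl}(\alpha_n)$. Then the Hecke group algebra $\mathrm{H}\mathring W$ is generated as a (unital) algebra by $\pi_0,\pi_1,\dots,\pi_n$. Alternatively, $\pi_0$ may be replaced by any $\Omega\in\mathring W$ mapping $\mathrm{cl}(\alpha_0)$ to a simple root (up to a positive scalar): for any such $\Omega$, $\mathrm{H}\mathring W$ is generated as an algebra by $\pi_1,\dots,\pi_n$ and the operator of right multiplication by $\Omega$.
   Context: Affine Weyl group. Let $M=(a_{i,j})_{i,j\in I}$, $I=\{0,\dots,n\}$, $n\ge1$, be an indecomposable generalized Cartan matrix of affine type (twisted or untwisted) and $W=\langle s_i\mid i\in I\rangle$ its affine Weyl group. Let $\mathfrak h^*=\bigoplus_{i\in I}\mathbb{R}\alpha_i$ and let $\mathfrak h=\bigoplus_{i\in I}\mathbb{R}\Lambda_i^\vee$ be its dual, $\langle\Lambda^\vee_i,\alpha_j\rangle=\delta_{ij}$; put $\alpha_i^\vee=\sum_j a_{i,j}\Lambda_j^\vee$, so $\langle\alpha_i^\vee,\alpha_j\rangle=a_{i,j}$. $W$ acts on $\mathfrak h$ by $s_i(x)=x-\langle x,\alpha_i\rangle\alpha_i^\vee$. Let $\delta=\sum_i a_i\alpha_i$, where the $a_i$ are the positive coprime integers with $\sum_j a_{i,j}a_j=0$ for all $i$. $W$ stabilizes $\mathfrak h^0=\{x\in\mathfrak h\mid\langle x,\delta\rangle=0\}$.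 The group $\mathring W$ is the (finite) image of $W$ in $GL(\mathfrak h^0)$, and $\mathrm{cl}:W\to\mathring W$ is the quotient map; nodes are labelled so that $\mathrm{cl}$ restricts to an isomorphism from $\langle s_1,\dots,s_n\rangle$ onto $\mathring W$, through which these groups are identified. $\mathrm{cl}(\alpha_i)$ denotes the restriction of $\alpha_i$ to $\mathfrak h^0$, an element of $(\mathfrak h^0)^*$, on which $\mathring W$ acts; $\mathrm{cl}(\alpha_1),\dots,\mathrm{cl}(\alpha_n)$ are the simple roots of $\mathring W$ and $\mathrm{cl}(\alpha_0)$ is a root of $\mathring W$ up to a positive scalar. Level $0$ actions and Hecke group algebra. Let $\mathring\rho^\vee\in\mathfrak h^0$ be the half sum of the positive coroots of $\mathring W$. On the vector space $\mathbb{C}\mathring W$ with basis $\mathring W$, operators act on the right: for $i\in I$, $w.\pi_i=w\,\mathrm{cl}(s_i)$ if $\langle w^{-1}(\mathring\rho^\vee),\alpha_i\rangle>0$, and $w.\pi_i=w$ otherwise. The Hecke group algebra $\mathrm{H}\mathring W$ is the unital subalgebra of $\mathrm{End}(\mathbb{C}\mathring W)$ generated by $\pi_1,\dots,\pi_n$ and the right multiplications by $s_1,\dots,s_n$. *)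

(* Defs.v *)
From HB Require Import structures.
From mathcomp Require Import all_boot all_order all_algebra all_fingroup.
From mathcomp Require Import boolp classical_sets functions reals.
From mathcomp.real_closed Require Import complex.

Set Implicit Arguments.
Unset Strict Implicit.
Unset Printing Implicit Defensive.

Import Order.TTheory GRing.Theory Num.Theory.

Local Open Scope classical_set_scope.
Local Open Scope ring_scope.

Section AffineCartanMatrix.
Variables (n : nat) (M : 'M[int]_n.+1).

Definition is_gcm : Prop :=
  [/\ forall i, M i i = 2,
      forall i j, i != j -> M i j <= 0 &
      forall i j, M i j = 0 -> M j i = 0].

Definition indecomposable : Prop :=
  forall J : {set 'I_n.+1}, J != finset.set0 -> J != [set: 'I_n.+1]%SET ->
    exists i j, [/\ i \in J, j \notin J & M i j != 0].

(* Case (Aff) of the trichotomy of V. Kac, Infinite dimensional Lie algebras,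
   Theorem 4.3, which is how affine type is defined there *)
Definition affine_type (R : realType) : Prop :=
  let A : 'M[R]_n.+1 := map_mx intr M in
  [/\ \rank A = n,
      exists u : 'cV[R]_n.+1, (forall i, 0 < u i 0) /\ A *m u = 0 &
      forall v : 'cV[R]_n.+1, (forall i, 0 <= (A *m v) i 0) -> A *m v = 0].

(* [a] is the family of coefficients of the null root delta *)
Definition null_root_coefs (a : 'I_n.+1 -> nat) : Prop :=
  [/\ forall i, (0 < a i)%N,
      \big[gcdn/0%N]_i a i = 1%N &
      forall i, \sum_j M i j * (a j)%:Z = 0].

End AffineCartanMatrix.

(* h is 'rV[R]_n.+1, with canonical basis the Lambda_i^vee, and h^* is
   'cV[R]_n.+1, with canonical basis the alpha_i *)
Section AffineWeylGroup.
Variables (R : realType) (n : nat).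
Local Notation h := 'rV[R]_n.+1.
Local Notation h' := 'cV[R]_n.+1.

Definition pairing (x : h) (y : h') : R := (x *m y) 0 0.

Lemma pairing_is_linear (y : h') :
  linear (fun x => pairing x y : R^o).
Proof. by move=> k u v; rewrite /pairing mulmxDl -scalemxAl !mxE. Qed.

Definition alpha (i : 'I_n.+1) : h' := delta_mx i 0.

Definition null_root (a : 'I_n.+1 -> nat) : h' := \sum_i (a i)%:R *: alpha i.

Section Reflections.
Variable M : 'M[int]_n.+1.

Definition alphav (i : 'I_n.+1) : h := \row_j (M i j)%:~R.

Definition refl_fun (i : 'I_n.+1) (x : h) : h :=
  x - pairing x (alpha i) *: alphav i.

Fact refl_fun_is_linear i : linear (refl_fun i).
Proof.
move=> k u v; rewrite /refl_fun (pairing_is_linear (alpha i)) scalerDl scalerBr.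
by rewrite scalerA opprD addrACA.
Qed.
HB.instance Definition _ i :=
  GRing.isLinear.Build R h h _ (refl_fun i) (refl_fun_is_linear i).

Definition refl (i : 'I_n.+1) : 'End(h) := linfun (refl_fun i).

Lemma reflE i x : refl i x = x - pairing x (alpha i) *: alphav i.
Proof. exact: lfunE. Qed.

Definition subgroup_of_GL (G : set 'End(h)) : Prop :=
  [/\ G \1%VF,
      forall f g, G f -> G g -> G (f \o g)%VF &
      forall f, G f -> G (f^-1)%VF].

(* the subgroup <s_i | i in J> of GL(h) *)
Definition refl_subgroup (J : set 'I_n.+1) : set 'End(h) :=
  smallest subgroup_of_GL (refl @` J).

Definition affine_Weyl : set 'End(h) := refl_subgroup [set: 'I_n.+1].

Definition parabolic : set 'End(h) := refl_subgroup [set i | i != ord0].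

End Reflections.

Section LevelZero.
Variable a : 'I_n.+1 -> nat.

Definition h0 : {vspace h} := lker (linfun (mulmxr (null_root a))).

Lemma mem_h0 x : (x \in h0) = (pairing x (null_root a) == 0).
Proof.
rewrite memv_ker lfunE /= /pairing; apply/eqP/eqP => [-> | e]; first by rewrite mxE.
by apply/matrixP=> i j; rewrite !ord1 e mxE.
Qed.

(* the restriction to h0 of an endomorphism of h which stabilizes h0 *)
Definition cl (g : 'End(h)) : 'End(subvs_of h0) :=
  linfun (vsproj h0 \o g \o vsval).

Lemma clE (g : 'End(h)) x : g (vsval x) \in h0 -> vsval (cl g x) = g (vsval x).
Proof. by move=> gx; rewrite lfunE /= vsprojK. Qed.

Definition cl_dual_fun (y : h') (x : subvs_of h0) : R^o := pairing (vsval x) y.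

Fact cl_dual_is_linear (y : h') : linear (cl_dual_fun y).
Proof.
by move=> k u v; rewrite /cl_dual_fun linearP (pairing_is_linear y).
Qed.
HB.instance Definition _ y :=
  GRing.isLinear.Build R (subvs_of h0) R^o _ (cl_dual_fun y)
    (cl_dual_is_linear y).

(* restriction of a linear form to h0 *)
Definition cl_dual (y : h') : 'Hom(subvs_of h0, R^o) := linfun (cl_dual_fun y).

Lemma cl_dualE y x : cl_dual y x = pairing (vsval x) y.
Proof. exact: lfunE. Qed.

End LevelZero.

Section FiniteWeylGroup.
Variables (M : 'M[int]_n.+1) (a : 'I_n.+1 -> nat).

Lemma alphav_h0 i : null_root_coefs M a -> alphav M i \in h0 a.
Proof.
case=> _ _ /(_ i) Ma; rewrite mem_h0 /pairing mulmx_sumr summxE; apply/eqP.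
rewrite -[RHS](rmorph0 (intr : {rmorphism int -> R})) -Ma rmorph_sum.
by apply: eq_bigr => j _; rewrite -scalemxAr mxE -colE !mxE rmorphM mulrC.
Qed.

Lemma refl_h0 i x : null_root_coefs M a -> x \in h0 a -> refl M i x \in h0 a.
Proof. by move=> Ma hx; rewrite reflE rpredB // rpredZ // alphav_h0. Qed.

Definition finite_Weyl : set 'End(subvs_of (h0 a)) := @cl a @` affine_Weyl M.

(* cl restricts to an isomorphism of <s_1, ..., s_n> onto the finite Weyl
   group; cl being multiplicative on W, this means that it is bijective *)
Definition good_labelling : Prop :=
  set_bij (parabolic M) finite_Weyl (@cl a).

(* The finite group [finite_Weyl], viewed as a finGroupType: [act] is an
   isomorphism of [gT] onto it, and [s i] is the element cl(s_i). *)
Record is_finite_Weyl (gT : finGroupType)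
    (act : gT -> 'End(subvs_of (h0 a))) (s : 'I_n.+1 -> gT) : Prop := {
  act_bij : set_bij [set: gT] finite_Weyl act;
  act_mul : forall u v : gT, act (u * v)%g = (act u \o act v)%VF;
  act_s : forall i, act (s i) = cl a (refl M i)
}.

Variables (gT : finGroupType) (act : gT -> 'End(subvs_of (h0 a))).
Variable (s : 'I_n.+1 -> gT).

Definition cl_alphav (i : 'I_n.+1) : subvs_of (h0 a) := vsproj (h0 a) (alphav M i).

Definition coroots : seq (subvs_of (h0 a)) :=
  undup [seq act w (cl_alphav i) | w <- enum gT, 
                                  i <- [seq j <- enum 'I_n.+1 | j != ord0]].

Definition positive_coroot (v : subvs_of (h0 a)) : Prop :=
  exists2 c : 'I_n.+1 -> R, forall i, 0 <= c i &
    v = \sum_(i | i != ord0) c i *: cl_alphav i.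

Definition rhov : subvs_of (h0 a) :=
  2^-1 *: \sum_(v <- coroots | `[< positive_coroot v >]) v.

(* action of gT on the dual of h0 *)
Definition dual_act (w : gT) (phi : 'Hom(subvs_of (h0 a), R^o)) :
  'Hom(subvs_of (h0 a), R^o) := (phi \o act w^-1%g)%VF.

Definition maps_alpha0_to_simple (Omega : gT) : Prop :=
  exists i (c : R), [/\ i != ord0, 0 < c &
    dual_act Omega (cl_dual a (alpha ord0)) = c *: cl_dual a (alpha i)].

End FiniteWeylGroup.
End AffineWeylGroup.

Section HeckeGroupAlgebra.
Variables (R : realType) (gT : finGroupType).

(* the vector space C[gT]; w : gT stands for the basis vector [basis w] *)
Local Notation groupC := {ffun gT -> R[i]^o}.

Definition basis (w : gT) : groupC := [ffun u => (u == w)%:R].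

Definition basis_op_fun (phi : gT -> gT) (f : groupC) : groupC :=
  \sum_w f w *: basis (phi w).

Fact basis_op_fun_is_linear phi : linear (basis_op_fun phi).
Proof.
move=> k f g; rewrite /basis_op_fun scaler_sumr -big_split /=.
by apply: eq_bigr => w _; rewrite !ffunE scalerDl scalerA.
Qed.
HB.instance Definition _ phi :=
  GRing.isLinear.Build R[i] groupC groupC _ (basis_op_fun phi)
    (basis_op_fun_is_linear phi).

Definition basis_op (phi : gT -> gT) : 'End(groupC) := linfun (basis_op_fun phi).

Lemma basis_opE phi w : basis_op phi (basis w) = basis (phi w).
Proof.
rewrite lfunE /= /basis_op_fun (bigD1 w) //= big1 => [|u /negPf uw].
  by rewrite ffunE eqxx scale1r addr0.
by rewrite ffunE uw scale0r.
Qed.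

Definition rmulop (u : gT) : 'End(groupC) := basis_op (fun w => w * u)%g.

(* Operators act on the right, i.e., End(C[gT]) has the product opposite to
   \o%VF; the unital subalgebras are the same for both products. *)
Definition unital_subalgebra (B : set 'End(groupC)) : Prop :=
  [/\ B \1%VF,
      forall (k : R[i]) f g, B f -> B g -> B (k *: f + g) &
      forall f g, B f -> B g -> B (f \o g)%VF].

Definition alg_gen (S : set 'End(groupC)) : set 'End(groupC) :=
  smallest unital_subalgebra S.

Variables (n : nat) (M : 'M[int]_n.+1) (a : 'I_n.+1 -> nat).
Variables (act : gT -> 'End(subvs_of (h0 R a))) (s : 'I_n.+1 -> gT).

Definition pi_op (i : 'I_n.+1) : 'End(groupC) :=
  basis_op (fun w =>
    if 0 < pairing (vsval (act w^-1%g (rhov M act))) (alpha R i)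
    then (w * s i)%g else w).

Definition Hecke_group_algebra : set 'End(groupC) :=
  alg_gen (pi_op @` [set i | i != ord0] `|`
           (rmulop \o s) @` [set i | i != ord0]).

End HeckeGroupAlgebra.

(* Main.v *)
(** Let A be the algebra generated by pi_0, ..., pi_n and, for a set K of
    finite nodes, P_K the space of vectors v of C[W] with s_k v = -v for all k
    in K.  All the operators of the Hecke group algebra preserve the P_K;
    conversely A contains every operator f preserving the P_K, in particular
    the right multiplications.  By induction, f may be assumed to vanish on
    P_K for K larger than J, and one has to match f on P_J by an element of A
    vanishing on the other P_K with |K| >= |J|.

    Let lambda be a dominant translation of the affine Weyl group with
    stabilizer W_J.  Folding along a reduced word of lambda fixes W_J
    pointwise and strictly lowers the other elements, so that some product F
    of the pi_i retracts W onto W_J.  Hence F has rank one on P_J and vanishes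
    on P_K unless K is contained in J.  Multiplying F on both sides by elements
    of A gives enough rank one operators: the range of F generates P_J under A
    because the graph of W_J\W with the moves that do not kill the
    antisymmetric vector of a coset is strongly connected (it carries a
    positive circulation); and a vector of P_J killed by F A lies in the sum of
    the P_K with K strictly larger than J, by reduction to the common
    eigenvectors of the 0-Hecke algebra.

    The reverse inclusion, and the generation by Omega, follow from
    pi_0 = Omega^-1 pi_i Omega (operators acting on the right). *)

From HB Require Import structures.
Require Import Defs.
From mathcomp Require Import all_boot all_order all_algebra all_fingroup.
From mathcomp Require Import boolp classical_sets functions reals.
From mathcomp.real_closed Require Import complex.
From mathcomp Require Import ring lra.

Set Implicit Arguments.
Unset Strict Implicit.
Unset Printing Implicit Defensive.

Import Order.TTheory GRing.Theory Num.Theory.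

Local Open Scope classical_set_scope.
Local Open Scope ring_scope.

(** * Operators preserving left antisymmetries *)

Section LinearFactor.
Variables (K : fieldType) (U V W : vectType K) (T : finType).

Definition lfun_family (G : T -> 'Hom(U, W)) (u : U) : {ffun T -> W} :=
  [ffun t => G t u].

Fact lfun_family_is_linear G : linear (lfun_family G).
Proof. by move=> k u v; apply/ffunP => t; rewrite !ffunE linearP. Qed.
HB.instance Definition _ G :=
  GRing.isLinear.Build K U {ffun T -> W} _ (lfun_family G)
    (lfun_family_is_linear G).

(** Gather the family into one map F, with pseudo-inverse [F^-1]. The vectors u and [F^-1 (F u)]
    have the same image under F, so their difference is killed by f. *)
Lemma lfun_factor (G : T -> 'Hom(U, W)) (f : 'Hom(U, V)) :
  (forall u, (forall t, G t u = 0) -> f u = 0) ->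
  exists k : 'Hom({ffun T -> W}, V), forall u, f u = k [ffun t => G t u].
Proof.
move=> fG; pose F := linfun (lfun_family G).
have FE u : F u = [ffun t => G t u] by rewrite lfunE.
exists (f \o F^-1)%VF => u; rewrite comp_lfunE -FE.
apply/eqP; rewrite -subr_eq0 -linearB; apply/eqP/fG => t.
have : F (u - (F^-1)%VF (F u)) = 0.
  by rewrite linearB /= limg_lfunVK ?subrr // memv_img ?memvf.
by rewrite FE => /ffunP/(_ t); rewrite !ffunE.
Qed.

End LinearFactor.

(** * Generated subalgebras and linear extensions of maps of the group *)

Section GeneratedSubalgebra.
Variables (R : realType) (gT : finGroupType).
Local Notation groupC := {ffun gT -> R[i]^o}.
Implicit Types S : set 'End(groupC).

Lemma sub_alg_gen S : S `<=` alg_gen S.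
Proof. by move=> f Sf B [_]; apply. Qed.

Lemma alg_gen_unital S : unital_subalgebra (alg_gen S).
Proof.
split=> [B [[B1 _ _] _] //|k f g Sf Sg B SB|f g Sf Sg B SB].
  by case: (SB) => -[_ BD _] _; apply: BD; [apply: Sf | apply: Sg].
by case: (SB) => -[_ _ BM] _; apply: BM; [apply: Sf | apply: Sg].
Qed.

Lemma alg_gen_min S B : unital_subalgebra B -> S `<=` B -> alg_gen S `<=` B.
Proof. by move=> uB SB f; apply. Qed.

Lemma alg_gen1 S : alg_gen S \1%VF.
Proof. by case: (alg_gen_unital S). Qed.

Lemma alg_genM S f g : alg_gen S f -> alg_gen S g -> alg_gen S (f \o g)%VF.
Proof. by case: (alg_gen_unital S) => _ _; apply. Qed.

Lemma alg_gen0 S : alg_gen S 0.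
Proof.
case: (alg_gen_unital S) => S1 SD _.
by have := SD (-1) _ _ S1 S1; rewrite scaleN1r addNr.
Qed.

Lemma alg_genZ S k f : alg_gen S f -> alg_gen S (k *: f).
Proof.
case: (alg_gen_unital S) => _ SD _ Sf.
by rewrite -[_ *: _]addr0; apply: SD => //; apply: alg_gen0.
Qed.

Lemma alg_genD S f g : alg_gen S f -> alg_gen S g -> alg_gen S (f + g).
Proof.
by case: (alg_gen_unital S) => _ SD _ Sf Sg; rewrite -[f]scale1r; apply: SD.
Qed.

Lemma alg_gen_sum S (T : Type) (r : seq T) (P : pred T) F :
  (forall i, P i -> alg_gen S (F i)) -> alg_gen S (\sum_(i <- r | P i) F i).
Proof.
move=> SF; elim/big_ind: _ => //; first exact: alg_gen0.
by move=> *; apply: alg_genD.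
Qed.

Lemma groupC_basis (v : groupC) : v = \sum_w v w *: basis R w.
Proof.
apply/ffunP => u; rewrite sum_ffunE (bigD1 u) //= big1 => [|w /negPf wu].
  by rewrite !ffunE eqxx addr0 /GRing.scale /= mulr1.
by rewrite !ffunE eq_sym wu /GRing.scale /= mulr0.
Qed.

Lemma basis_op_coef (phi : gT -> gT) (v : groupC) u :
  basis_op R phi v u = \sum_(w | phi w == u) v w.
Proof.
rewrite lfunE /= /basis_op_fun sum_ffunE [RHS]big_mkcond /=.
apply: eq_bigr => w _; rewrite !ffunE eq_sym.
by case: eqP => _; rewrite /GRing.scale /= ?mulr1 ?mulr0.
Qed.

#[local] Opaque basis_op.

Lemma eq_basis_op (phi psi : gT -> gT) : phi =1 psi -> basis_op R phi = basis_op R psi.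
Proof. by move=> /funext ->. Qed.

Lemma lfun_basis (f g : 'End(groupC)) :
  (forall w, f (basis R w) = g (basis R w)) -> f = g.
Proof.
move=> e; apply/lfunP => v; rewrite [v]groupC_basis !linear_sum /=.
by apply: eq_bigr => w _; rewrite !linearZ /= e.
Qed.

Lemma basis_op_comp (phi psi : gT -> gT) :
  basis_op R (phi \o psi) = (basis_op R phi \o basis_op R psi)%VF.
Proof.
apply: lfun_basis => w; rewrite comp_lfunE.
exact: etrans (basis_opE R _ w)
  (esym (etrans (congr1 (basis_op R phi) (basis_opE R psi w)) (basis_opE R phi _))).
Qed.

Lemma basis_op_id : basis_op R (@id gT) = \1%VF.
Proof. by apply: lfun_basis => w; rewrite basis_opE id_lfunE. Qed.

Lemma rmulopM (u v : gT) : rmulop R (u * v)%g = (rmulop R v \o rmulop R u)%VF.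
Proof.
by rewrite /rmulop -basis_op_comp; apply: eq_basis_op => w /=; rewrite mulgA.
Qed.

Lemma rmulop1 : rmulop R (1%g : gT) = \1%VF.
Proof. by rewrite -basis_op_id; apply: eq_basis_op => w; rewrite mulg1. Qed.

Lemma alg_gen_rmulop_prod S (T : Type) (s : T -> gT) (l : seq T) (P : pred T) :
  (forall i, P i -> alg_gen S (rmulop R (s i))) -> all P l ->
  alg_gen S (rmulop R (\prod_(i <- l) s i)%g).
Proof.
move=> Ss; elim: l => [|i l IH] /=; first by rewrite big_nil rmulop1 => _;
  apply: alg_gen1.
by case/andP=> Pi /IH Sl; rewrite big_cons rmulopM; exact: alg_genM Sl (Ss i Pi).
Qed.

Lemma alg_gen_rmulop_expg S (u : gT) k :
  alg_gen S (rmulop R u) -> alg_gen S (rmulop R (u ^+ k)%g).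
Proof.
move=> Su; elim: k => [|k IH]; first by rewrite expg0 rmulop1; apply: alg_gen1.
by rewrite expgS rmulopM; apply: alg_genM.
Qed.

(** In a finite group the inverse of u is a power of u. *)
Lemma alg_gen_rmulopV S (u : gT) :
  alg_gen S (rmulop R u) -> alg_gen S (rmulop R u^-1%g).
Proof. by rewrite invg_expg; apply: alg_gen_rmulop_expg. Qed.

End GeneratedSubalgebra.

(** * Foldings and antisymmetric vectors, for an abstract ascent relation [p] *)

Section Antisymmetries.
Variables (R : realType) (gT : finGroupType) (n : nat).
Local Notation I := 'I_n.+1.
Local Notation groupC := {ffun gT -> R[i]^o}.
#[local] Opaque basis_op.

Implicit Types J K L : {set I}.

Variables (s : I -> gT) (p : gT -> I -> bool).

Definition word_prod (l : seq I) : gT := (\prod_(i <- l) s i)%g.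
Local Notation sw := word_prod.

Definition in_parabolic (J : {set I}) (y : gT) : Prop :=
  exists2 l, all (mem J) l & y = sw l.
Local Notation inW := in_parabolic.

Definition fold_step (w : gT) (i : I) : gT := if p w i then (w * s i)%g else w.

Definition fold_word (w : gT) (l : seq I) : gT := foldl fold_step w l.

Hypothesis sK : forall i, (s i * s i = 1)%g.
Hypothesis p_s : forall w i, p (w * s i)%g i = ~~ p w i.
Hypothesis p_left : forall w i j, j != ord0 ->
  (s j * w = w * s i)%g \/ p (s j * w)%g i = p w i.

Lemma sw_cat l1 l2 : sw (l1 ++ l2) = (sw l1 * sw l2)%g.
Proof. exact: big_cat. Qed.

Lemma sw_cons i l : sw (i :: l) = (s i * sw l)%g.
Proof. exact: big_cons. Qed.

Lemma sw_nil : sw [::] = 1%g.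
Proof. exact: big_nil. Qed.

Lemma sV i : (s i)^-1%g = s i.
Proof. by apply/eqP; rewrite eq_invg_mul sK. Qed.

Lemma sw_rev l : sw (rev l) = (sw l)^-1%g.
Proof.
elim: l => [|i l IH]; first by rewrite sw_nil invg1.
by rewrite rev_cons -cats1 sw_cat IH sw_cons sw_cons sw_nil mulg1 invMg sV.
Qed.

Lemma inW1 J : inW J 1%g.
Proof. by exists [::]; rewrite ?sw_nil. Qed.

Lemma inWM J x y : inW J x -> inW J y -> inW J (x * y)%g.
Proof.
by move=> [l Jl ->] [m Jm ->]; exists (l ++ m); rewrite ?sw_cat ?all_cat ?Jl.
Qed.

Lemma inWV J x : inW J x -> inW J x^-1%g.
Proof. by move=> [l Jl ->]; exists (rev l); rewrite ?sw_rev ?all_rev. Qed.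

Lemma inWs (J : {set I}) j : j \in J -> inW J (s j).
Proof. by move=> Jj; exists [:: j]; rewrite /= ?Jj ?sw_cons ?sw_nil ?mulg1. Qed.

Lemma inWMl J x y : inW J x -> inW J (x * y)%g -> inW J y.
Proof. by move=> /inWV Wx Wxy; rewrite -(mulKg x y); apply: inWM. Qed.

Lemma inWMr J x y : inW J y -> inW J (x * y)%g -> inW J x.
Proof. by move=> /inWV Wy Wxy; rewrite -(mulgK y x); apply: inWM. Qed.

Lemma inW_ind (J : {set I}) (P : gT -> Prop) :
  P 1%g -> (forall j y, j \in J -> inW J y -> P y -> P (s j * y)%g) ->
  forall y, inW J y -> P y.
Proof.
move=> P1 Ps _ [l + ->]; elim: l => [|j l IH] /=; first by rewrite sw_nil.
by case/andP=> Jj Jl; rewrite sw_cons; apply: Ps => //; [exists l | apply: IH].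
Qed.

(** This property of a map makes its linear extension preserve antisymmetries; it is stable under
    composition. *)
Definition left_folding (phi : gT -> gT) : Prop := forall j w, j != ord0 ->
  phi (s j * w)%g = phi w \/ phi (s j * w)%g = (s j * phi w)%g.

Lemma left_folding_comp phi psi :
  left_folding phi -> left_folding psi -> left_folding (phi \o psi).
Proof.
move=> fphi fpsi j w j0 /=; case: (fpsi j w j0) => ->; first by left.
exact: fphi.
Qed.

(** In the exceptional case of [p_left], w and $s_j w$ are the two ends of one edge labelled i, and
    the folding sends both to the same end. *)
Lemma left_folding_step i : left_folding (fold_step^~ i).
Proof.
move=> j w j0 /=; rewrite /fold_step; case: (p_left w i j0) => [e|->].
  left; rewrite e p_s; case: (p w i) => //=.
  by rewrite -mulgA sK mulg1.
by case: ifP => _; right; rewrite ?mulgA.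
Qed.

Lemma left_folding_word l : left_folding (fold_word^~ l).
Proof.
elim/last_ind: l => [|l i IH]; first by move=> j w _; right.
move=> j w j0; rewrite /fold_word -!cats1 !foldl_cat.
exact: (left_folding_comp (@left_folding_step i) IH).
Qed.

Lemma left_folding_mulr u : left_folding (fun w => w * u)%g.
Proof. by move=> j w _; right; rewrite mulgA. Qed.

Definition antisym (J : {set I}) (v : groupC) : Prop :=
  forall j w, j \in J -> v (s j * w)%g = - v w.

(** The sum of the coefficients at $s_j u$ and u is a sum of terms [v w * g w], where g is invariant
    under left multiplication by $s_j$ and v changes sign; so it equals its opposite. *)
Lemma antisym_basis_op phi J v : left_folding phi -> ord0 \notin J ->
  antisym J v -> antisym J (basis_op R phi v).
Proof.
move=> fphi J0 av j u Jj.
have j0 : j != ord0 by apply: contraNneq J0 => <-.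
apply/eqP; rewrite -addr_eq0.
pose g w : R[i] := (phi w == (s j * u)%g)%:R + (phi w == u)%:R.
have -> : basis_op R phi v (s j * u)%g + basis_op R phi v u = \sum_w v w * g w.
  rewrite !basis_op_coef [X in X + _]big_mkcond [X in _ + X]big_mkcond -big_split /=.
  apply: eq_bigr => w _.
  by rewrite mulrDr; case: eqP => _; case: eqP => _; rewrite ?mulr0 ?mulr1.
have gs w : g (s j * w)%g = g w.
  rewrite /g; case: (fphi j w j0) => -> //; rewrite addrC; congr (_%:R + _%:R).
    by congr nat_of_bool; apply/eqP/eqP => [<-|->]; rewrite mulgA sK mul1g.
  by rewrite (inj_eq (mulgI _)).
set t := (X in X == 0); have : t = - t.
  rewrite {1}/t (reindex_inj (mulgI (s j))) -sumrN; apply: eq_bigr => w _.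
  by rewrite gs av // mulNr.
by move/eqP; rewrite eq_sym eqNr.
Qed.

Lemma antisym_sub J K v : J \subset K -> antisym K v -> antisym J v.
Proof. by move=> /fintype.subsetP JK av j w /JK; apply: av. Qed.

Lemma antisymB J u v : antisym J u -> antisym J v -> antisym J (u - v).
Proof. by move=> au av j w Jj; rewrite !ffunE au // av // opprD. Qed.

Lemma antisymD J u v : antisym J u -> antisym J v -> antisym J (u + v).
Proof. by move=> au av j w Jj; rewrite !ffunE au // av // opprD. Qed.

Lemma antisymZ J k v : antisym J v -> antisym J (k *: v).
Proof. by move=> av j w Jj; rewrite !ffunE av // scalerN. Qed.

Lemma antisym0 J : antisym J 0.
Proof. by move=> j w _; rewrite !ffunE oppr0. Qed.

Lemma antisym_sum J (T : Type) (r : seq T) (P : pred T) (F : T -> groupC) :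
  (forall t, P t -> antisym J (F t)) -> antisym J (\sum_(t <- r | P t) F t).
Proof.
move=> aF; elim/big_ind: _ => //; [exact: antisym0 | exact: antisymD].
Qed.

Variable chi : gT -> R[i].
Hypothesis chiM : forall u v, chi (u * v)%g = chi u * chi v.
Hypothesis chi_s : forall i, chi (s i) = -1.

Lemma chi1 : chi 1%g = 1.
Proof. by rewrite -(sK ord0) chiM chi_s mulrNN mulr1. Qed.

Lemma chi_neq0 u : chi u != 0.
Proof.
apply/eqP => u0; have /eqP := chi1.
by rewrite -(mulgV u) chiM u0 mul0r eq_sym oner_eq0.
Qed.

Lemma antisymE J v y w : inW J y -> antisym J v -> v (y * w)%g = chi y * v w.
Proof.
move=> Wy av; elim/inW_ind: Wy => [|j x Jj _ IH]; first by rewrite mul1g chi1 mul1r.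
by rewrite -mulgA av // IH chiM chi_s mulN1r mulNr.
Qed.

Definition coset_antisym (J : {set I}) (w : gT) : groupC :=
  \sum_(y | `[<inW J y>]) chi y *: basis R (y * w)%g.
Local Notation cW := coset_antisym.

Lemma cWE J w x :
  cW J w x = if `[<inW J (x * w^-1)%g>] then chi (x * w^-1)%g else 0.
Proof.
rewrite /cW sum_ffunE big_mkcond (bigD1 (x * w^-1)%g) //= big1 => [|y /negPf yx].
  by rewrite addr0; case: ifP => // _;
    rewrite !ffunE mulgKV eqxx /GRing.scale /= mulr1.
case: ifP => // _; rewrite !ffunE; case: eqP => [e|]; last by rewrite scaler0.
by rewrite e mulgK eqxx in yx.
Qed.

Lemma cW_id J w : cW J w w = 1.
Proof. by rewrite cWE mulgV chi1; case: asboolP => // -[]; apply: inW1. Qed.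

Lemma antisym_cW J w : antisym J (cW J w).
Proof.
move=> j x Jj; rewrite !cWE -mulgA.
have -> : `[<inW J (s j * (x * w^-1))%g>] = `[<inW J (x * w^-1)%g>].
  by apply/asbool_equiv_eq; split=> [/(inWMl (inWs Jj))|/(inWM (inWs Jj))].
by case: ifP => _; rewrite ?oppr0 // chiM chi_s mulN1r.
Qed.

(** The vector [v w *: cW J w] depends only on the coset $W_J w$, so a sum over the whole group
    counts it $|W_J|$ times. *)
Lemma antisym_span J v : antisym J v ->
  v = \sum_w (v w / (#|[pred y | `[<inW J y>]]|)%:R) *: cW J w.
Proof.
move=> av; apply/ffunP => x; rewrite sum_ffunE.
set N := (_%:R); have N0 : N != 0.
  rewrite pnatr_eq0 -lt0n; apply/card_gt0P; exists 1%g.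
  by rewrite unfold_in /=; apply: asboolT; apply: inW1.
under eq_bigr => w _.
  rewrite ffunE cWE.
  have -> : (v w / N) *: (if `[<inW J (x * w^-1)%g>] then chi (x * w^-1)%g else 0 : R[i]^o)
     = if `[<inW J (x * w^-1)%g>] then v x / N else 0.
    case: asboolP => [Wx|_]; last by rewrite scaler0.
    rewrite -[in RHS](mulgKV w x) (antisymE _ Wx av) /GRing.scale /=.
    by rewrite mulrAC [v w * _]mulrC.
  over.
rewrite -big_mkcond /= sumr_const -mulr_natr.
have -> : #|[pred w | `[<inW J (x * w^-1)%g>]]| = #|[pred y | `[<inW J y>]]|.
  rewrite -!sum1_card [RHS](reindex_inj (h := fun w => x * w^-1)%g) //.
  by move=> u w /mulgI/invg_inj.
by rewrite -/N divfK.
Qed.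

Lemma cW_mul J y w : inW J y -> cW J (y * w)%g = (chi y)^-1 *: cW J w.
Proof.
move=> Wy; apply/ffunP => x; rewrite !ffunE !cWE invMg mulgA.
have -> : `[<inW J (x * w^-1 * y^-1)%g>] = `[<inW J (x * w^-1)%g>].
  by apply/asbool_equiv_eq; split=> [/(inWMr (inWV Wy))|Wx] //;
    apply: inWM Wx (inWV Wy).
case: ifP => _; rewrite ?scaler0 // /GRing.scale /= chiM mulrC; congr (_ * _).
by apply: (mulfI (chi_neq0 y)); rewrite -chiM mulgV chi1 divff ?chi_neq0.
Qed.

(** A height plays the role of the length. By [h_top] and [h_bot], an element with no left ascent
    (resp. no left descent) in J is the strict maximum (resp. minimum) of its coset $W_J x$. *)
Variable h : gT -> nat.
Hypothesis h_s : forall w i, i != ord0 -> (h w < h (w * s i)%g)%N = p w i.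
Hypothesis hV : forall w, h w^-1%g = h w.
Hypothesis h_top : forall J x y, ord0 \notin J ->
  (forall j, j \in J -> ~~ p x^-1%g j) -> inW J y -> y != 1%g ->
  (h (y * x)%g < h x)%N.
Hypothesis h_bot : forall J x y, ord0 \notin J ->
  (forall j, j \in J -> p x^-1%g j) -> inW J y -> y != 1%g ->
  (h x < h (y * x)%g)%N.
Hypothesis inW_full : forall w, inW [set~ ord0]%SET w.
Hypothesis s_notin : forall J j, ord0 \notin J -> j != ord0 -> j \notin J ->
  ~ inW J (s j).

Lemma h_left w k : k != ord0 -> (h w < h (s k * w)%g)%N = p w^-1%g k.
Proof. by move=> k0; rewrite -(h_s _ k0) hV -(hV (s k * w)) invMg sV. Qed.

(** By [h_top] for the set of all finite nodes, each of two distinct such elements would be strictly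
    higher than the other. *)
Lemma longest_uniq x y : (forall i, i != ord0 -> ~~ p x i) ->
  (forall i, i != ord0 -> ~~ p y i) -> x = y.
Proof.
have half u v : (forall i, i != ord0 -> ~~ p u i) -> u != v -> (h v < h u)%N.
  move=> lu uv; rewrite -(hV v) -(hV u) -(mulgK u v^-1%g).
  apply: (@h_top [set~ ord0]%SET); rewrite ?inE ?eqxx //.
    by move=> j; rewrite !inE invgK; apply: lu.
  by rewrite -(inj_eq (mulgI v)) mulKVg mulg1.
move=> lx ly; apply/eqP/negPn/negP => xy.
by have := ltn_trans (half _ _ lx xy) (half y x ly _);
  rewrite ltnn eq_sym => /(_ xy).
Qed.

Lemma longest_max x w : (forall i, i != ord0 -> ~~ p x i) -> (h w <= h x)%N.
Proof.
move=> lx; case: (@arg_maxnP _ 1%g predT h) => // z _ zmax.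
suff -> : x = z by apply: zmax.
by apply: longest_uniq => // i i0; rewrite -h_s // -leqNgt; apply: zmax.
Qed.

Lemma longestV x : (forall i, i != ord0 -> ~~ p x i) ->
  forall i, i != ord0 -> ~~ p x^-1%g i.
Proof. by move=> lx i i0; rewrite -h_left // -leqNgt; apply: longest_max. Qed.

Lemma sN1 i : s i != 1%g.
Proof.
by apply/eqP => si; have := p_s 1%g i; rewrite si mulg1; case: (p _ _).
Qed.

(** Otherwise [p_left] would leave $s_d x^{-1}$ without ascents, like $x^{-1}$; uniqueness of the
    longest element would then give $s_d = 1$. *)
Lemma longest_conj x d : d != ord0 -> (forall i, i != ord0 -> ~~ p x i) ->
  exists j, [/\ j != ord0, (x * s d = s j * x)%g & p (x * s d)^-1%g j].
Proof.
move=> d0 lx; apply: contrapT => nex.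
have lxV := longestV lx.
suff e : (s d * x^-1 = x^-1)%g.
  by have /eqP := sN1 d; case; apply: (mulIg x^-1%g); rewrite mul1g.
apply: longest_uniq => // j j0; case: (p_left x^-1%g j d0) => [e|->];
  last exact: lxV.
case: nex; exists j; split=> //.
  by apply: invg_inj; rewrite !invMg !sV.
by rewrite invMg sV e p_s lxV.
Qed.

Lemma fold_step_coef (x : groupC) i u :
  basis_op R (fold_step^~ i) x u = if p u i then 0 else x u + x (u * s i)%g.
Proof.
rewrite basis_op_coef; case: ifP => pu.
  rewrite big_pred0 // => w; apply/eqP; rewrite /fold_step; case: ifP => pw e.
    by move: pu; rewrite -e p_s pw.
  by rewrite -e pw in pu.
rewrite (bigD1 u) /= ?/fold_step ?pu //; congr (_ + _).
rewrite (bigD1 (u * s i)%g) /=; last first.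
  rewrite p_s pu /= -mulgA sK mulg1 eqxx /= -{2}(mulg1 u) (inj_eq (mulgI u)).
  exact: sN1.
rewrite big1 ?addr0 // => w /andP[/andP[/eqP + wu] wus]; case: ifP => pw e.
  by case/eqP: wus; rewrite -e -mulgA sK mulg1.
by rewrite e eqxx in wu.
Qed.

(** * One set J of nodes: operators through a retraction onto $W_J$ *)

Section Retraction.
Variable J : {set I}.
Hypothesis J0 : ord0 \notin J.
Variable lF : seq I.
Hypothesis lF_im : forall w, inW J (fold_word w lF).
Hypothesis lF_id : forall y, inW J y -> fold_word y lF = y.
Hypothesis transit : forall w u, exists l y0, inW J y0 /\
  forall y, inW J y -> fold_word (y * w)%g l = (y * (y0 * u))%g.

Local Notation T l := (basis_op R (fold_word^~ l)).

Lemma T_cat l1 l2 : T (l1 ++ l2) = (T l2 \o T l1)%VF.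
Proof.
by rewrite -basis_op_comp; apply: eq_basis_op => w; rewrite /fold_word foldl_cat.
Qed.

Definition killed (x : groupC) := forall l, T (l ++ lF) x = 0.

Let K := [set k | (k != ord0) && (k \notin J)]%SET.

(** The values lie in $W_J$, and multiplication by $s_k$ with k outside J would leave it; so a left
    folding has to be constant along k. *)
Lemma fold_retr_const l w y : inW K y ->
  fold_word (y * w)%g (l ++ lF) = fold_word w (l ++ lF).
Proof.
move=> Wy; elim/inW_ind: Wy w => [w|k x + _ IH w]; first by rewrite mul1g.
rewrite inE -mulgA => /andP[k0 kJ].
case: (left_folding_word (l ++ lF) (x * w)%g k0) => /= [->|e]; first exact: IH.
have im u : inW J (fold_word u (l ++ lF)) by rewrite /fold_word foldl_cat.
by case: (s_notin J0 k0 kJ); apply: inWMr (im (x * w)%g) _; rewrite -e.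
Qed.

Lemma antisym_T L l v : ord0 \notin L -> antisym L v -> antisym L (T l v).
Proof. exact: antisym_basis_op (left_folding_word l). Qed.

Lemma retr_support v w : T lF v w != 0 -> inW J w.
Proof.
rewrite basis_op_coef; apply: contraNP => Ww.
by rewrite big_pred0 // => u; apply/eqP => e; case: Ww; rewrite -e.
Qed.

(** The image is supported in $W_J$ and antisymmetric for some k outside J, whereas $s_k$ moves
    $W_J$ off itself. *)
Lemma retr_kills L v : ord0 \notin L -> ~~ (L \subset J) -> antisym L v ->
  T lF v = 0.
Proof.
move=> L0 /fintype.subsetPn[k Lk kJ] av; apply/ffunP => w; rewrite [RHS]ffunE.
apply/eqP/negPn/negP => vw.
have k0 : k != ord0 by apply: contraNneq L0 => <-.
case: (s_notin J0 k0 kJ); apply: inWMr (retr_support vw) _.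
by apply: (@retr_support v); rewrite (antisym_T lF L0 av) // oppr_eq0.
Qed.

Lemma killed_antisym L v : ord0 \notin L -> ~~ (L \subset J) -> antisym L v ->
  killed v.
Proof.
by move=> L0 LJ av l; rewrite T_cat comp_lfunE (retr_kills L0 LJ) //;
  apply: antisym_T.
Qed.

Definition left_top (x : groupC) :=
  forall w k, x w != 0 -> k \in K -> ~~ p w^-1%g k.

(** The weight reverses the height, so that upward folding decreases the total weight of a
    support. *)
Let weight w := #|[pred x | h w <= h x]%N|.
Let wsize (x : groupC) := (\sum_(w | x w != 0%R) weight w)%N.

Let weight_lt w w' : (h w < h w')%N -> (weight w' < weight w)%N.
Proof.
move=> lt; apply/proper_card/fintype.properP; split.
  by apply/fintype.subsetP => x; rewrite !inE; apply/leq_trans/ltnW.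
by exists w; rewrite !inE ?leqnn // -ltnNge.
Qed.

Lemma step_id (x : groupC) i : (forall w, x w != 0 -> ~~ p w i) ->
  basis_op R (fold_step^~ i) x = x.
Proof.
move=> px; apply/ffunP => w; rewrite fold_step_coef.
case: ifP => pw; first by apply/esym/eqP/negPn/negP => /px; rewrite pw.
suff -> : x (w * s i)%g = 0 by rewrite addr0.
by apply/eqP/negPn/negP => /px; rewrite p_s pw.
Qed.

(** Charge each element of the new support to a preimage in the old one, whose weight is at least as
    large; [w0] moves up and loses weight strictly. *)
Lemma step_size (x : groupC) i w0 : i != ord0 -> x w0 != 0 -> p w0 i ->
  (wsize (basis_op R (fold_step^~ i) x) < wsize x)%N.
Proof.
move=> i0 xw0 pw0; set y := basis_op _ _ _.
apply: (@leq_ltn_trans (\sum_(w | x w != 0%R) weight (fold_step w i))%N).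
  rewrite (partition_big (fold_step^~ i) predT) //=.
  rewrite (bigID (fun u => y u != 0)) /=; apply: leq_trans (leq_addr _ _).
  apply: leq_sum => u yu.
  have [w /andP[xw /eqP pw]] : exists w, (x w != 0) && (fold_step w i == u).
    apply/existsP; apply: contraNT yu => /existsPn nex.
    rewrite /y basis_op_coef big1 // => w pw; apply/eqP/negPn/negP => xw.
    by have := nex w; rewrite xw pw.
  by rewrite (bigD1 w) /= ?xw ?pw ?eqxx // leq_addr.
rewrite /wsize (bigD1 w0) //= [X in (_ < X)%N](bigD1 w0) //= -addSn leq_add //.
  by rewrite /fold_step pw0; apply: weight_lt; rewrite h_s.
apply: leq_sum => w _; rewrite /fold_step; case: ifP => // pw.
by apply/ltnW/weight_lt; rewrite h_s.
Qed.

Lemma killed_step (x : groupC) i : killed x -> killed (basis_op R (fold_step^~ i) x).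
Proof.
move=> kx l; have := kx (i :: l); rewrite -cat1s -catA T_cat comp_lfunE.
by congr (T _ _ = 0); congr (fun_of_lfun _ _); apply: eq_basis_op.
Qed.

Lemma left_top_step (x : groupC) i : i != ord0 -> left_top x ->
  left_top (basis_op R (fold_step^~ i) x).
Proof.
move=> i0 tx w k + Kk; rewrite fold_step_coef.
have k0 : k != ord0 by move: Kk; rewrite inE => /andP[].
case: ifP => [_ /eqP //|/negbT pw]; have [xw|xw] := eqVneq (x w) 0; last first.
  by move=> _; apply: tx.
rewrite xw add0r => /tx /(_ Kk); rewrite invMg sV.
case: (p_left w^-1%g k i0) => [e _|-> //].
(* Here $w s_i = s_k w$, so both ascents compare the heights of the same two elements. *)
have <- : p w i = p w^-1%g k.
  rewrite -h_s // -h_left //; congr (_ < h _)%N.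
  by apply: invg_inj; rewrite !invMg !sV e.
by [].
Qed.

(* Each [fold_step^~ i] with [i != ord0] strictly decreases the weight of the
   support of [x] unless it fixes [x]; so a nonzero [x] of minimal weight is
   fixed or killed by all of them.  Its support is then [w1 W_D], with [w1] the
   longest element, and lies in [W_J w1], which [transit] maps injectively. *)
Lemma killed_left_top (x : groupC) : killed x -> left_top x -> x = 0.
Proof.
elim: {x}(wsize x).+1 {-2}x (ltnSn (wsize x)) => // m IH x sx kx tx.
apply/eqP/negPn/negP => x0.
have T01 i : i != ord0 -> basis_op R (fold_step^~ i) x = 0 \/
    basis_op R (fold_step^~ i) x = x.
  move=> i0; case: (pselect (exists w, x w != 0 /\ p w i)) => [[w [xw pw]]|nex].
    left; apply: IH; [|exact: killed_step|exact: left_top_step].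
    exact: leq_trans (step_size i0 xw pw) sx.
  by right; apply: step_id => w xw; apply/negP => pw; apply: nex; exists w.
pose D := [set i | (i != ord0) && (basis_op R (fold_step^~ i) x == 0)]%SET.
have D0 : ord0 \notin D by rewrite inE eqxx.
(* A zero image under folding along i means that the values at w and $w s_i$ cancel. *)
have xD i w : i \in D -> x w != 0 -> x (w * s i)%g != 0.
  rewrite inE => /andP[i0 /eqP/ffunP Tx]; apply: contraNneq => xs.
  case pw: (p w i).
    by have := Tx (w * s i)%g;
      rewrite fold_step_coef p_s pw /= xs add0r -mulgA sK mulg1 ffunE => ->.
  by have := Tx w; rewrite fold_step_coef pw xs addr0 ffunE => ->.
have xND i w : i != ord0 -> i \notin D -> x w != 0 -> ~~ p w i.
  move=> i0; rewrite inE i0 /= => Tx; apply: contraNN => pw.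
  case: (T01 i i0) => [e|<-]; first by rewrite e eqxx in Tx.
  by rewrite fold_step_coef pw.
have [w0 xw0] : exists w, x w != 0.
  apply: contrapT => nex; case/eqP: x0; apply/ffunP => w; rewrite [RHS]ffunE.
  by apply/eqP/negPn/negP => xw; apply: nex; exists w.
have longest w : x w != 0 -> (forall i, i \in D -> (h (w * s i)%g <= h w)%N) ->
    forall i, i != ord0 -> ~~ p w i.
  move=> xw wD i i0; case: (boolP (i \in D)) => iD; last exact: xND.
  by rewrite -h_s // -leqNgt wD.
have [w1 xw1 w1max] := @arg_maxnP _ w0 (fun w => x w != 0) h xw0.
have lw1 : forall i, i != ord0 -> ~~ p w1 i.
  by apply: longest => // i iD; apply/w1max/xD.
have xWD y w : inW D y -> x w != 0 -> x (w * y)%g != 0.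
  move=> Wy; elim/inW_ind: Wy w => [w|j z Dj _ Hz w xw]; first by rewrite mulg1.
  by rewrite mulgA; apply/Hz/xD.
have supp w : x w != 0 -> exists2 y, inW D y & w = (w1 * y)%g.
  move=> xw.
  have W1 : `[<inW D 1%g>] by apply: asboolT; apply: inW1.
  have [y /asboolP Wy ymax] :=
    @arg_maxnP _ 1%g (fun y => `[<inW D y>]) (fun y => h (w * y)%g) W1.
  exists y^-1%g; first exact: inWV.
  suff -> : w1 = (w * y)%g by rewrite mulgK.
  apply: longest_uniq => //; apply: longest; first exact: xWD.
  move=> i Di; rewrite -mulgA; apply/ymax/asboolP/inWM => //; exact: inWs.
(* A node j outside J would contradict [left_top] at $w_1 s_d$, which belongs to the support. *)
have conj d : d \in D -> exists2 j, j \in J & (w1 * s d = s j * w1)%g.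
  move=> Dd; have d0 : d != ord0 by apply: contraNneq D0 => <-.
  have [j [j0 e pj]] := longest_conj d0 lw1; exists j => //.
  apply: contraLR pj => jJ; apply: tx; first exact: xD.
  by rewrite inE j0.
have conjW y : inW D y -> exists2 z, inW J z & (w1 * y = z * w1)%g.
  elim/inW_ind => [|d z Dd _ [z' Wz' e]]; first by exists 1%g;
    rewrite ?mulg1 ?mul1g //; apply: inW1.
  have [j Jj ej] := conj d Dd; exists (s j * z')%g; first by apply/inWM/Wz'/inWs.
  by rewrite mulgA ej -mulgA e mulgA.
have [l [y0 [Wy0 ly0]]] := transit w1 1%g.
(* Within the support only [w1] is sent to [y0], so the coefficient there is the nonzero [x w1]. *)
have /ffunP/(_ y0) := kx l; rewrite basis_op_coef ffunE => /eqP; apply/negP.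
rewrite (bigID (fun w => x w == 0)) /= big1 ?add0r => [|w /andP[_ /eqP //]].
have fw z : inW J z -> fold_word (z * w1)%g (l ++ lF) = (z * y0)%g.
  move=> Wz; rewrite /fold_word foldl_cat -!/(fold_word _ _) ly0 // mulg1.
  by rewrite lF_id //; apply: inWM.
rewrite (bigD1 w1) /= ?big1 ?addr0 //.
  move=> w /andP[/andP[/eqP lw xw] /eqP[]].
  have [y /conjW[z Wz e] we] := supp _ xw; rewrite we e.
  suff -> : z = 1%g by rewrite mul1g.
  by apply: (mulIg y0); rewrite mul1g -fw // -e -we.
by have := fw 1%g (inW1 J); rewrite !mul1g => ->; rewrite eqxx.
Qed.

(* The operators [T (l ++ lF)] are constant on the left cosets of [W_K], so [v]
   can be pushed to the tops of these cosets. *)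
Lemma killed_descent v u : killed v -> v u != 0 ->
  (forall w, v w != 0 -> (h w <= h u)%N) ->
  exists2 k, k \in K & ~~ p u^-1%g k.
Proof.
move=> kv vu umax; apply: contrapT => nex.
have pu k : k \in K -> p u^-1%g k.
  by move=> Kk; apply/negPn/negP => pk; apply: nex; exists k.
have K0 : ord0 \notin K by rewrite inE eqxx.
have topP w : exists y, inW K y /\ forall k, k \in K -> ~~ p (y * w)^-1%g k.
  have W1 : `[<inW K 1%g>] by apply: asboolT; apply: inW1.
  have [y /asboolP Wy ymax] :=
    @arg_maxnP _ 1%g (fun y => `[<inW K y>]) (fun y => h (y * w)%g) W1.
  exists y; split=> // k Kk; rewrite -h_left; last by move: Kk;
    rewrite inE => /andP[].
  by rewrite -leqNgt mulgA; apply/ymax/asboolP/inWM => //; exact: inWs.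
have [t tP] := boolp.choice topP.
pose top w := (t w * w)%g.
(* If no such k exists, u is the bottom of its coset $W_K u$. Being highest in the support, it is
   alone there, so the coefficient at [top u] is [v u]. *)
suff : basis_op R top v = 0.
  move=> /ffunP/(_ (top u));
    rewrite basis_op_coef ffunE (bigD1 u) //= big1 ?addr0 => [/eqP|w].
    exact/negP.
  case/andP=> /eqP tw wu; apply/eqP/negPn/negP => /umax; apply/negP;
    rewrite -ltnNge.
  have e : w = ((t w)^-1 * t u * u)%g by rewrite -mulgA -/(top u) -tw /top mulKg.
  rewrite [X in (_ < h X)%N]e; apply: (@h_bot K) => //.
    by apply: inWM; [apply: inWV|]; have [] := tP w; have [] := tP u.
  by apply: contraNneq wu => e1; rewrite e e1 mul1g.
apply: killed_left_top.
  move=> l; have e : basis_op R (fold_word^~ (l ++ lF) \o top) = T (l ++ lF).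
    by apply: eq_basis_op => w; apply: fold_retr_const; have [] := tP w.
  have k := kv l; rewrite -e basis_op_comp in k.
  exact: etrans (esym (comp_lfunE _ _ v)) k.
move=> w k; rewrite basis_op_coef => + Kk; apply: contraNN => pk.
rewrite big_pred0 // => x; apply/eqP => e; move: pk; rewrite -e.
by apply/negP; have [_] := tP x; apply.
Qed.

(** Induction on a strict bound for the heights in the support of v. An element u of the top layer
    is the highest of its coset for [Du u], which strictly contains J by antisymmetry and
    [killed_descent]. Subtracting [v u *: cW (Du u) u] for all these u removes the layer; f vanishes
    on these vectors, and they are antisymmetric for J and killed. *)
Lemma separation (f : 'End(groupC)) v :
  (forall L x, ord0 \notin L -> J \proper L -> antisym L x -> f x = 0) ->
  antisym J v -> killed v -> f v = 0.
Proof.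
move=> fL.
suff H m : forall u : groupC, (forall w, u w != 0 -> (h w < m)%N) ->
    antisym J u -> killed u -> f u = 0.
  by apply: (H (\max_w h w).+1) => w _; rewrite ltnS leq_bigmax.
elim: m => [|m IH] {}v vm av kv.
  have -> : v = 0; last by rewrite linear0.
  by apply/ffunP => w; rewrite [RHS]ffunE; apply/eqP/negPn/negP => /vm.
pose Du u := [set k | (k != ord0) && ~~ p u^-1%g k]%SET.
have Du0 u : ord0 \notin Du u by rewrite inE eqxx.
pose isL u := (v u != 0) && (h u == m).
have JDu u : isL u -> J \proper Du u.
  case/andP=> vu /eqP hu; apply/fintype.properP; split.
    apply/fintype.subsetP => j Jj; rewrite inE.
    have -> /= : j != ord0 by apply: contraNneq J0 => <-.
    by rewrite -h_left -?leqNgt ?hu; [apply/vm;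
      rewrite av // oppr_eq0 | apply: contraNneq J0 => <-].
  have [|k] := killed_descent kv vu; first by move=> w /vm; rewrite ltnS hu.
  by rewrite inE => /andP[k0 kJ] pk; exists k => //; rewrite inE k0.
have ncW u : isL u -> ~~ (Du u \subset J) by move/JDu; rewrite properE => /andP[].
pose c := \sum_(u | isL u) v u *: cW (Du u) u.
have fc : f c = 0.
  rewrite linear_sum big1 // => u Lu; rewrite linearZ /=.
  by rewrite (fL _ _ (Du0 u) (JDu u Lu)) ?scaler0 //; apply: antisym_cW.
suff : f (v - c) = 0 by rewrite linearB /= fc subr0.
apply: IH.
- move=> w; apply: contraNltn; rewrite leq_eqVlt => mw; rewrite !ffunE sum_ffunE.
  have cw u : isL u -> u != w -> cW (Du u) u w = 0.
    move=> Lu uw; rewrite cWE; case: asboolP => // Ww; exfalso.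
    have H : (w * u^-1)%g != 1%g.
      by apply: contraNneq uw => e; rewrite -(mulgKV u w) e mul1g.
    have tu k : k \in Du u -> ~~ p u^-1%g k by rewrite inE => /andP[].
    have := h_top (Du0 u) tu Ww H; rewrite mulgKV.
    by case/andP: (Lu) => _ /eqP ->; rewrite ltnNge leq_eqVlt mw.
  case: (boolP (isL w)) => Lw.
    rewrite (bigD1 w) //= big1 => [|u /andP[Lu uw]].
      by rewrite !ffunE cW_id addr0 /GRing.scale /= mulr1 subrr.
    by rewrite ffunE cw // scaler0.
  rewrite big1 => [|u Lu].
    move: Lw; rewrite negb_and negbK; case/orP=> [/eqP ->|hw];
      first by rewrite subr0.
    rewrite subr0; apply/negPn/negP => /vm; rewrite ltnS leqNgt.
    by case/orP: mw => [/eqP e|->//]; rewrite e eqxx in hw.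
  by rewrite ffunE cw ?scaler0 //; apply: contraNneq Lw => <-.
- apply: antisymB => //; apply: antisym_sum => u Lu; apply: (@antisymZ J (v u));
  apply: (@antisym_sub J (Du u)).
    by case/andP: (JDu u Lu).
  exact: antisym_cW.
- move=> l; rewrite linearB /= kv linear_sum big1 ?subr0 // => u Lu.
  rewrite linearZ /= (killed_antisym (Du0 u) (ncW u Lu)) ?scaler0 //.
  exact: antisym_cW.
Qed.

Local Notation A := (alg_gen (range (fun i => basis_op R (fold_step^~ i)))).

Lemma alg_T l : A (T l).
Proof.
elim/last_ind: l => [|l i IH].
  have -> : T [::] = \1%VF by rewrite -basis_op_id; exact: eq_basis_op.
  exact: alg_gen1.
by rewrite -cats1 T_cat; apply: alg_genM IH; apply: sub_alg_gen; exists i.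
Qed.

(** The word given by [transit] moves the elements of $W_J$ in parallel onto the coset $W_J u$,
    without merging any two of them. *)
Lemma coset_antisym_transit u : exists2 g, A g & g (cW J 1%g) = cW J u.
Proof.
have [l [y0 [Wy0 ly0]]] := transit 1%g u.
exists (chi y0 *: T l); first exact: alg_genZ (alg_T l).
rewrite scale_lfunE.
have -> : T l (cW J 1%g) = cW J (y0 * u)%g.
  rewrite /cW linear_sum; apply: eq_bigr => y /asboolP Wy.
  by rewrite linearZ -(ly0 y Wy) /= [in LHS](basis_opE R (fold_word^~ l)).
by rewrite cW_mul // scalerA mulfV ?scale1r // chi_neq0.
Qed.

Lemma antisym_cyclic v : antisym J v -> exists2 g, A g & g (cW J 1%g) = v.
Proof.
move=> /antisym_span ->.
have ex w : exists g, A g /\ g (cW J 1%g) = cW J w.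
  by have [g] := coset_antisym_transit w; exists g.
have [g gP] := boolp.choice ex.
exists (\sum_w (v w / (#|[pred y | `[<inW J y>]]|)%:R) *: g w).
  by apply: alg_gen_sum => w _; apply: alg_genZ; have [] := gP w.
by rewrite sum_lfunE; apply: eq_bigr => w _; rewrite scale_lfunE (gP w).2.
Qed.

(** This is the rank one property: an antisymmetric vector supported in $W_J$ is determined by its
    value at 1. *)
Lemma retr_antisym v : antisym J v -> T lF v = T lF v 1%g *: cW J 1%g.
Proof.
move=> /(antisym_T lF J0) av; apply/ffunP => w; rewrite [RHS]ffunE cWE invg1 mulg1.
case: asboolP => Ww; first by rewrite -{1}(mulg1 w) (antisymE _ Ww av) mulrC.
by rewrite scaler0; apply/eqP/negPn/negP => /retr_support.
Qed.

Lemma antisym_proj : exists pr : 'End(groupC),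
  (forall v, antisym J (pr v)) /\ (forall v, antisym J v -> pr v = v).
Proof.
pose N : R[i] := (#|[pred y | `[<inW J y>]]|)%:R.
(* The projector onto the sign component for left multiplication by $W_J$. *)
exists (N^-1 *: \sum_(y | `[<inW J y>]) chi y *: basis_op R (fun w => y * w)%g).
set pr := _ *: _.
have prE v : pr v = \sum_w (v w / N) *: cW J w.
  rewrite {1}[v]groupC_basis linear_sum; apply: eq_bigr => w _.
  rewrite linearZ /= -scalerA; congr (_ *: _); rewrite scale_lfunE; congr (_ *: _).
  rewrite sum_lfunE; apply: eq_bigr => y _; rewrite scale_lfunE.
  by rewrite [in LHS](basis_opE R (fun w => y * w)%g).
split=> v; last by move=> /antisym_span {2}->; apply: prE.
by rewrite prE; apply: antisym_sum => w _; apply: antisymZ; apply: antisym_cW.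
Qed.

(** By [separation] and [lfun_factor], f on J-antisymmetric vectors is a linear function k of the
    images under the operators [G phi]. Each image is a multiple of [cW J 1], so only finitely many
    values of k matter, and [antisym_cyclic] realizes each of them inside the algebra. *)
Lemma local_agree (f : 'End(groupC)) :
  (forall v, antisym J v -> antisym J (f v)) ->
  (forall L x, ord0 \notin L -> J \proper L -> antisym L x -> f x = 0) ->
  exists g, [/\ A g, forall v, antisym J v -> g v = f v &
    forall L x, ord0 \notin L -> ~~ (L \subset J) -> antisym L x -> g x = 0].
Proof.
move=> fJ fL; have [pr [prJ prid]] := antisym_proj.
(* There are infinitely many words, but the maps they induce form a finite type, as [lfun_factor]
   requires. *)
pose E (phi : {ffun gT -> gT}) := `[<exists l, phi =1 fold_word^~ l>].
pose G phi : 'End(groupC) := if E phi then (T lF \o basis_op R phi)%VF else 0.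
have GT phi : E phi -> exists l, G phi = T (l ++ lF).
  move=> Ephi; rewrite /G Ephi; case/asboolP: Ephi => l /eq_basis_op ->.
  by exists l; rewrite T_cat.
have GA phi : A (G phi).
  case: (boolP (E phi)) => [/GT[l ->]|/negbTE e]; first exact: alg_T.
  by rewrite /G e; apply: alg_gen0.
have [|k kP] :=
  @lfun_factor _ groupC groupC groupC _ (fun phi => G phi \o pr)%VF (f \o pr)%VF.
  move=> v Gv; rewrite comp_lfunE; apply: separation => // l.
  pose phi := [ffun w => fold_word w l].
  have Ephi : E phi by apply: asboolT; exists l => w; rewrite ffunE.
  have := Gv phi; rewrite comp_lfunE /G Ephi T_cat.
  by have /eq_basis_op -> : phi =1 fold_word^~ l by move=> w; rewrite ffunE.
pose D phi : {ffun {ffun gT -> gT} -> groupC} :=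
  [ffun psi => if psi == phi then cW J 1%g else 0].
have ex phi : exists a, A a /\ a (cW J 1%g) = pr (k (D phi)).
  by have [a] := antisym_cyclic (prJ (k (D phi))); exists a.
have [a aP] := boolp.choice ex.
exists (\sum_phi (a phi \o G phi)%VF); split.
- by apply: alg_gen_sum => phi _; apply: alg_genM; [have [] := aP phi | apply: GA].
- move=> v av; rewrite sum_lfunE -[RHS]prid; last exact: fJ.
  have Gv phi : G phi v = G phi v 1%g *: cW J 1%g.
    case: (boolP (E phi)) => [/GT[l ->]|/negbTE e].
      by rewrite T_cat comp_lfunE {1}retr_antisym //; apply: antisym_T.
    by rewrite /G e lfunE /= ffunE scale0r.
  have := kP v; rewrite comp_lfunE (prid v av) => ->.
  rewrite (_ : [ffun phi => _] = \sum_phi G phi v 1%g *: D phi).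
    rewrite !linear_sum; apply: eq_bigr => phi _.
    by rewrite comp_lfunE [X in a phi X]Gv !linearZ /= (aP phi).2.
  apply/ffunP => psi;
    rewrite ffunE sum_ffunE (bigD1 psi) //= big1 ?addr0 => [|phi /negPf ne].
    by rewrite !ffunE eqxx comp_lfunE prid // {1}Gv.
  by rewrite !ffunE eq_sym ne scaler0.
- move=> L x L0 LJ ax; rewrite sum_lfunE big1 // => phi _; rewrite comp_lfunE.
  suff -> : G phi x = 0 by rewrite linear0.
  case: (boolP (E phi)) => [/GT[l ->]|/negbTE e]; last by rewrite /G e lfunE.
  exact: killed_antisym LJ ax l.
Qed.

End Retraction.

(** * Induction over the sets of nodes *)

Hypothesis retr : forall J, ord0 \notin J -> exists l,
  (forall w, inW J (fold_word w l)) /\ (forall y, inW J y -> fold_word y l = y).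
Hypothesis transit : forall J w u, ord0 \notin J -> exists l y0, inW J y0 /\
  forall y, inW J y -> fold_word (y * w)%g l = (y * (y0 * u))%g.

Local Notation A := (alg_gen (range (fun i => basis_op R (fold_step^~ i)))).

Definition preserves_antisym (f : 'End(groupC)) : Prop := forall J v,
  ord0 \notin J -> antisym J v -> antisym J (f v).

Lemma alg_preserves_antisym f : A f -> preserves_antisym f.
Proof.
apply: (alg_gen_min (B := preserves_antisym)).
  split=> [J v _|k f1 g1 Hf Hg J v J0 av|f1 g1 Hf Hg J v J0 av];
    first by rewrite id_lfunE.
    by rewrite add_lfunE scale_lfunE; apply: antisymD; [apply: antisymZ;
      apply: Hf|apply: Hg].
  by rewrite comp_lfunE; apply: Hf => //; apply: Hg.
by move=> _ [i _ <-] J v J0; apply: antisym_basis_op => //;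
  apply: left_folding_step.
Qed.

(** The integer k bounds from below the size of the sets L on which f is known to vanish. To lower
    the bound, subtract the operators of [local_agree] for all J of size k: each of them vanishes on
    the antisymmetric vectors of any other L of size at least k. For k = 0 the empty set gives f =
    0. *)
Theorem alg_of_preserves_antisym f : preserves_antisym f -> A f.
Proof.
suff H k : forall f, preserves_antisym f -> (forall L x, ord0 \notin L ->
    (k <= #|L|)%N -> antisym L x -> f x = 0) -> A f.
  (* The bound [n.+2] exceeds the number of nodes, so the vanishing condition is void. *)
  move=> fP; apply: (H n.+2) => // L x L0; rewrite leqNgt ltnS.
  by have := max_card (mem L); rewrite card_ord => ->.
elim: k => [|k IH] {}f fP fk.
  suff -> : f = 0 by apply: alg_gen0.
  apply/lfunP => x; rewrite [RHS]lfunE /=; apply: (fk finset.set0) => //;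
    first by rewrite inE.
  by move=> j w; rewrite inE.
have ex J : exists g, A g /\ (ord0 \notin J -> #|J| = k ->
    (forall v, antisym J v -> g v = f v) /\
    forall L x, ord0 \notin L -> ~~ (L \subset J) -> antisym L x -> g x = 0).
  case: (pselect (ord0 \notin J /\ #|J| = k)) => [[J0 Jk]|nJ]; last first.
    by exists 0; split=> [|J0 Jk]; [exact: alg_gen0 | case: nJ].
  have [l [l_im l_id]] := retr J0.
  have [|L x L0 JL|g [Ag gf gL]] :=
    local_agree J0 l_im l_id (fun w u => transit w u J0) (f := f).
  - by move=> v; apply: fP.
  - by apply: fk => //; rewrite -Jk; apply: proper_card.
  - by exists g.
have [g gP] := boolp.choice ex.
pose G := \sum_(J : {set I} | (ord0 \notin J) && (#|J| == k)) g J.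
have AG : A G by apply: alg_gen_sum => J _; have [] := gP J.
rewrite -(subrK G f); apply: alg_genD => //; apply: IH.
  move=> J v J0 av; rewrite add_lfunE opp_lfunE; apply: antisymB; first exact: fP.
  exact: (alg_preserves_antisym AG).
move=> L x L0 kL aL; rewrite add_lfunE opp_lfunE sum_lfunE.
have gLx J : ord0 \notin J -> #|J| = k -> L != J -> g J x = 0.
  move=> J0 Jk LJ; have [_ /(_ J0 Jk)[_ kill]] := gP J; apply: kill aL => //.
  by apply: contra LJ => LJ; rewrite eqEcard LJ Jk.
have [Lk|Lk] := eqVneq #|L| k.
  rewrite (bigD1 L) ?L0 ?Lk ?eqxx //= big1 => [|J /andP[/andP[J0 /eqP Jk] JL]].
    by have [_ /(_ L0 Lk)[-> // _]] := gP L; rewrite addr0 subrr.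
  by apply: gLx => //; rewrite eq_sym.
rewrite big1 ?subr0 => [|J /andP[J0 /eqP Jk]].
  by apply: (fk L) => //; rewrite ltn_neqAle eq_sym Lk.
by apply: gLx => //; apply: contraNneq Lk => ->; rewrite Jk.
Qed.

End Antisymmetries.

(** * Roots of the affine Weyl group and their restriction to h^0 *)

Lemma sum_sym_even (m : nat) (F : 'I_m -> 'I_m -> int) :
  (forall i j, F i j = F j i) -> (forall i, exists t, F i i = t *+ 2) ->
  exists t, \sum_i \sum_j F i j = t *+ 2.
Proof.
move=> Fsym Fdiag; have [t tP] := boolp.choice Fdiag.
exists (\sum_i t i + \sum_(i < m) \sum_(j < m | (j < i)%N) F i j).
rewrite mulrnDl -sumrMnl.
have -> : \sum_i \sum_j F i j = \sum_(i < m) F i i +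
    (\sum_(i < m) \sum_(j < m | (j < i)%N) F i j + \sum_(i < m) \sum_(j < m | (i < j)%N) F i j).
  rewrite -!big_split /=; apply: eq_bigr => i _.
  rewrite (bigD1 i) //=; congr (_ + _).
  rewrite (bigID (fun j : 'I_m => (j < i)%N)) /=; congr (_ + _);
    apply: eq_bigl => j.
    by rewrite -(inj_eq val_inj) /=; case: ltngtP.
  by rewrite -(inj_eq val_inj) /=; case: ltngtP.
congr (_ + _); first by apply: eq_bigr => i _; rewrite tP.
rewrite mulr2n; congr (_ + _).
rewrite (exchange_big_dep predT) //=; apply: eq_bigr => i _; apply: eq_bigr => j _.
exact: Fsym.
Qed.

(** Compare two block triangular factorizations of B, one for each Schur complement. This gives the
    sign of a reflection in [det_act_s]. *)
Lemma det_rank1 (K : comNzRingType) (m : nat) (u : 'cV[K]_m) (r : 'rV[K]_m) :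
  \det (1%:M - u *m r) = 1 - (r *m u) 0 0.
Proof.
pose B := block_mx (1%:M : 'M_1) r u 1%:M.
have B1 : B = block_mx 1%:M 0 u 1%:M *m block_mx 1%:M r 0 (1%:M - u *m r).
  by rewrite mulmx_block !mul1mx ?mulmx1 ?mul0mx ?mulmx0 !addr0
    [X in block_mx _ _ _ X]addrC subrK.
have B2 : B = block_mx (1%:M - r *m u) r 0 1%:M *m block_mx 1%:M 0 u 1%:M.
  by rewrite mulmx_block ?mul1mx ?mulmx1 ?mul0mx ?mulmx0 ?add0r subrK.
have := B1; rewrite B2 => /(congr1 determinant).
rewrite !det_mulmx !det_ublock !det_lblock !det1 !mul1r !mulr1 => <-.
by rewrite det_mx11 !mxE eqxx.
Qed.

(** * The action of the finite group on $h^0$ and an invariant form *)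

Section RootSystem.
Variables (R : realType) (n : nat) (M : 'M[int]_n.+1).
Variables (a : 'I_n.+1 -> nat) (gT : finGroupType).
Variables (act : gT -> 'End(subvs_of (h0 R a))) (s : 'I_n.+1 -> gT).
Hypothesis M_gcm : is_gcm M.
Hypothesis a_null : null_root_coefs M a.
Hypothesis Wfin : is_finite_Weyl M act s.

Local Notation I := 'I_n.+1.
Local Notation V := (subvs_of (h0 R a)).
Local Notation av := (@cl_alphav R n M a).
Local Notation sw := (word_prod s).

Definition ev (x : V) (i : I) : R := pairing (vsval x) (alpha R i).

Lemma pairing_alpha (x : 'rV[R]_n.+1) i : pairing x (alpha R i) = x 0 i.
Proof.
rewrite /pairing mxE (bigD1 i) //= big1 => [|j /negPf ji].
  by rewrite mxE !eqxx mulr1 addr0.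
by rewrite mxE ji mulr0.
Qed.

Lemma evE x i : ev x i = vsval x 0 i.
Proof. exact: pairing_alpha. Qed.

Lemma evD x y i : ev (x + y) i = ev x i + ev y i.
Proof. by rewrite !evE linearD mxE. Qed.
Lemma evZ k x i : ev (k *: x) i = k * ev x i.
Proof. by rewrite !evE linearZ mxE. Qed.
Lemma evN x i : ev (- x) i = - ev x i.
Proof. by rewrite !evE linearN mxE. Qed.
Lemma ev0 i : ev 0 i = 0.
Proof. by rewrite evE linear0 mxE. Qed.
Lemma evB x y i : ev (x - y) i = ev x i - ev y i.
Proof. by rewrite evD evN. Qed.
Lemma ev_sum (T : Type) (r : seq T) (P : pred T) (F : T -> V) i :
  ev (\sum_(t <- r | P t) F t) i = \sum_(t <- r | P t) ev (F t) i.
Proof.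
by apply: (big_morph (fun x => ev x i)) => [x y|]; [apply: evD | apply: ev0].
Qed.

Lemma ev_inj x y : (forall i, ev x i = ev y i) -> x = y.
Proof.
by move=> e; apply/val_inj/rowP => i; have := e i; rewrite !evE.
Qed.

Lemma vsval_av i : vsval (av i) = alphav R M i.
Proof. by rewrite vsprojK // alphav_h0. Qed.

Lemma ev_av i j : ev (av i) j = (M i j)%:~R.
Proof. by rewrite evE vsval_av mxE. Qed.

Lemma ev_av_diag i : ev (av i) i = 2.
Proof. by case: M_gcm => d _ _; rewrite ev_av d. Qed.

Lemma ev_null x : \sum_i (a i)%:R * ev x i = 0.
Proof.
have := subvsP x; rewrite mem_h0 => /eqP e; rewrite -[RHS]e.
rewrite /pairing mxE; apply: eq_bigr => i _; rewrite mulrC evE; congr (_ * _).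
rewrite /null_root summxE (bigD1 i) //= big1 => [|j /negPf ji].
  by rewrite !mxE !eqxx mulr1 addr0.
by rewrite !mxE eq_sym ji mulr0.
Qed.

Lemma a_gt0 i : 0 < (a i)%:R :> R.
Proof. by case: a_null => ap _ _; rewrite ltr0n. Qed.

Lemma act_s_val i x : act (s i) x = x - ev x i *: av i.
Proof.
rewrite (act_s Wfin); apply: val_inj => /=.
rewrite clE; first by rewrite reflE vsval_av.
by rewrite refl_h0 // subvsP.
Qed.

Lemma act_inj : injective act.
Proof. by case: (act_bij Wfin) => _ inj _ u v e; apply: inj; rewrite ?inE. Qed.

Lemma affine_Weyl1 : @affine_Weyl R n M \1%VF.
Proof. by move=> G [[G1 _ _] _]. Qed.

Lemma act1 : act 1%g = \1%VF.
Proof.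
have [u _ uE] : (act @` setT) \1%VF.
  case: (act_bij Wfin) => _ _ surj; apply: surj; exists \1%VF;
    first exact: affine_Weyl1.
  by apply/lfunP => x; apply: val_inj => /=; rewrite clE ?id_lfunE // subvsP.
have : act (u * u)%g = act u by rewrite (act_mul Wfin) uE comp_lfun1l.
by move/act_inj/(canRL (mulgK u)); rewrite mulgV => <-.
Qed.

Lemma actM u v x : act (u * v)%g x = act u (act v x).
Proof. by rewrite (act_mul Wfin) comp_lfunE. Qed.

Lemma actK u x : act u^-1%g (act u x) = x.
Proof. by rewrite -actM mulVg act1 id_lfunE. Qed.

Lemma actKV u x : act u (act u^-1%g x) = x.
Proof. by rewrite -actM mulgV act1 id_lfunE. Qed.

(** An invariant inner product, obtained by summing the coordinatewise one over the finite group. *)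
Definition bil (x y : V) : R := \sum_w \sum_i ev (act w x) i * ev (act w y) i.

Lemma bilC x y : bil x y = bil y x.
Proof. by apply: eq_bigr => w _; apply: eq_bigr => i _; rewrite mulrC. Qed.

Lemma bilDl x y z : bil (x + y) z = bil x z + bil y z.
Proof.
rewrite -big_split; apply: eq_bigr => w _; rewrite -big_split;
  apply: eq_bigr => i _.
by rewrite linearD evD mulrDl.
Qed.
Lemma bilZl k x z : bil (k *: x) z = k * bil x z.
Proof.
rewrite mulr_sumr; apply: eq_bigr => w _; rewrite mulr_sumr; apply: eq_bigr => i _.
by rewrite linearZ evZ mulrA.
Qed.
Lemma bilNl x z : bil (- x) z = - bil x z.
Proof. by rewrite -scaleN1r bilZl mulN1r. Qed.
Lemma bilBl x y z : bil (x - y) z = bil x z - bil y z.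
Proof. by rewrite bilDl bilNl. Qed.
Lemma bil0l z : bil 0 z = 0.
Proof. by rewrite -(scale0r 0) bilZl mul0r. Qed.
Lemma bilDr x y z : bil z (x + y) = bil z x + bil z y.
Proof. by rewrite bilC bilDl !(bilC z). Qed.
Lemma bilZr k x z : bil z (k *: x) = k * bil z x.
Proof. by rewrite bilC bilZl (bilC z). Qed.
Lemma bilNr x z : bil z (- x) = - bil z x.
Proof. by rewrite bilC bilNl (bilC z). Qed.
Lemma bilBr x y z : bil z (x - y) = bil z x - bil z y.
Proof. by rewrite bilDr bilNr. Qed.
Lemma bil_suml (T : Type) (r : seq T) (P : pred T) (F : T -> V) z :
  bil (\sum_(t <- r | P t) F t) z = \sum_(t <- r | P t) bil (F t) z.
Proof.
by apply: (big_morph (fun x => bil x z)) => [x y|]; [apply: bilDl | apply: bil0l].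
Qed.
Lemma bil_sumr (T : Type) (r : seq T) (P : pred T) (F : T -> V) z :
  bil z (\sum_(t <- r | P t) F t) = \sum_(t <- r | P t) bil z (F t).
Proof. by rewrite bilC bil_suml; apply: eq_bigr => t _; rewrite bilC. Qed.

Lemma bil_act u x y : bil (act u x) (act u y) = bil x y.
Proof.
rewrite /bil [RHS](reindex_inj (mulIg u)) /=; apply: eq_bigr => w _.
by apply: eq_bigr => i _; rewrite !actM.
Qed.

Lemma bil_actl u x y : bil (act u x) y = bil x (act u^-1%g y).
Proof. by rewrite -(bil_act u^-1%g) actK. Qed.

Lemma bil_gt0 x : x != 0 -> 0 < bil x x.
Proof.
move=> x0; rewrite lt_def; apply/andP; split; last first.
  by apply: sumr_ge0 => w _; apply: sumr_ge0 => i _; rewrite -expr2 sqr_ge0.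
apply: contraNneq x0 => bx; apply/eqP/ev_inj => i; rewrite ev0; apply/eqP.
move/eqP: bx; rewrite psumr_eq0 => [/allP/(_ 1%g)|w _]; last first.
  by apply: sumr_ge0 => j _; rewrite -expr2 sqr_ge0.
rewrite mem_index_enum => /(_ isT); rewrite psumr_eq0 => [/allP/(_ i)|j _];
  last first.
  by rewrite -expr2 sqr_ge0.
by rewrite mem_index_enum => /(_ isT); rewrite act1 id_lfunE mulf_eq0 orbb.
Qed.

Lemma bil_ge0 x : 0 <= bil x x.
Proof. by have [->|/bil_gt0/ltW //] := eqVneq x 0; rewrite bil0l. Qed.

Lemma av_neq0 i : av i != 0.
Proof.
apply/eqP => e; have /eqP := ev_av_diag i.
by rewrite e ev0 eq_sym pnatr_eq0.
Qed.

(** These numbers symmetrize the Cartan matrix, see [dd_sym]. *)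
Definition dd i : R := bil (av i) (av i) / 2.

Lemma dd_gt0 i : 0 < dd i.
Proof. by rewrite divr_gt0 // bil_gt0 // av_neq0. Qed.

Lemma dd_neq0 i : dd i != 0.
Proof. by rewrite gt_eqF // dd_gt0. Qed.

Lemma act_s_av i : act (s i) (av i) = - av i.
Proof.
by rewrite act_s_val ev_av_diag scaler_nat mulr2n opprD addNKr.
Qed.

(* [s i] is orthogonal for [bil], which makes the affine Cartan matrix
   symmetrizable without any case analysis on Dynkin diagrams. *)
Lemma bil_av x i : bil x (av i) = dd i * ev x i.
Proof.
have := bil_act (s i) x (av i); rewrite act_s_av act_s_val bilNr bilBl bilZl.
by rewrite /dd => e; lra.
Qed.

Lemma sK i : (s i * s i = 1)%g.
Proof.
apply: act_inj; apply/lfunP => x; rewrite actM act1 id_lfunE !act_s_val.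
have e : ev x i + (ev x i - ev x i * 2) = 0 by ring.
by rewrite evB evZ ev_av_diag -addrA -opprD -scalerDl e scale0r subr0.
Qed.

Lemma act_eq u v : (forall i, act u (av i) = act v (av i)) -> u = v.
Proof.
move=> e; apply: act_inj; apply/lfunP => x; apply: (can_inj (actKV u));
  rewrite actK.
apply: ev_inj => i; apply: (mulfI (dd_neq0 i)); rewrite -!bil_av.
by rewrite -[RHS](bil_act u) actKV e bil_act.
Qed.

Lemma act_conj_s w i x :
  act (w * s i * w^-1)%g x = x - (bil (act w (av i)) x / dd i) *: act w (av i).
Proof.
have e : ev (act w^-1%g x) i = bil (act w (av i)) x / dd i.
  by rewrite bil_actl bilC bil_av mulrC mulKf // dd_neq0.
rewrite (actM (w * s i)%g) (actM w) act_s_val e.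
by rewrite [LHS]linearB [X in _ - X]linearZ /= (actKV w x).
Qed.

(* Row vectors are coordinates, on the alpha_i, of linear forms on h; [phi]
   is restriction to h^0 followed by the identification given by [bil]. *)
Definition phi (xi : 'rV[R]_n.+1) : V := \sum_i (xi 0 i / dd i) *: av i.

Definition evx (x : V) (xi : 'rV[R]_n.+1) : R := \sum_i xi 0 i * ev x i.

Definition al (i : I) : 'rV[R]_n.+1 := delta_mx 0 i.

Definition delta : 'rV[R]_n.+1 := \row_i (a i)%:R.

Lemma bil_phi x xi : bil x (phi xi) = evx x xi.
Proof.
rewrite bil_sumr; apply: eq_bigr => i _; rewrite bilZr bil_av.
by rewrite mulrA divfK // dd_neq0.
Qed.

Fact phi_is_linear : linear phi.
Proof.
move=> k u v; rewrite /phi scaler_sumr -big_split; apply: eq_bigr => i _ /=.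
by rewrite !mxE mulrDl scalerDl scalerA mulrA.
Qed.
HB.instance Definition _ := GRing.isLinear.Build R 'rV[R]_n.+1 V _ phi phi_is_linear.

Lemma phi_al i : phi (al i) = (dd i)^-1 *: av i.
Proof.
rewrite /phi (bigD1 i) //= big1 => [|j /negPf ji].
  by rewrite mxE !eqxx addr0 mul1r.
by rewrite mxE eqxx ji mul0r scale0r.
Qed.

Lemma av_phi i : av i = dd i *: phi (al i).
Proof. by rewrite phi_al scalerA divff ?scale1r // dd_neq0. Qed.

Lemma evx_al x i : evx x (al i) = ev x i.
Proof. by rewrite -bil_phi phi_al bilZr bil_av mulKf // dd_neq0. Qed.

Lemma ev_phi xi i : ev (phi xi) i = evx (av i) xi / dd i.
Proof. by rewrite -bil_phi bilC bil_av mulrC mulKf // dd_neq0. Qed.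

Lemma phi_delta : phi delta = 0.
Proof.
apply: ev_inj => i; rewrite ev0 ev_phi /evx.
under eq_bigr do rewrite mxE.
by rewrite ev_null mul0r.
Qed.

(** The forms vanishing on $h^0$ are the multiples of delta. It is enough to evaluate on the vectors
    $a_0\Lambda_i^\vee - a_i\Lambda_0^\vee$ of $h^0$. *)
Lemma phi_eq0 xi : phi xi = 0 -> xi = (xi 0 ord0 / (a ord0)%:R) *: delta.
Proof.
move=> e; apply/rowP => i; rewrite !mxE.
have [->|i0] := eqVneq i ord0; first by rewrite divfK // gt_eqF // a_gt0.
pose x : 'rV[R]_n.+1 := (a ord0)%:R *: delta_mx 0 i - (a i)%:R *: delta_mx 0 ord0.
have xh : x \in h0 R a.
  rewrite mem_h0 /pairing mulmxBl -!scalemxAl -!rowE !mxE.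
  rewrite /null_root !summxE (bigD1 i) //= [in X in _ - X](bigD1 ord0) //= !big1.
  - by rewrite !mxE !eqxx !mulr1 !addr0 mulrC subrr.
  - by move=> j /negPf ji; rewrite !mxE eq_sym ji mulr0.
  - by move=> j /negPf ji; rewrite !mxE eq_sym ji mulr0.
have : evx (vsproj _ x) xi = 0.
  by rewrite -bil_phi e bilC bil0l.
rewrite /evx (bigD1 i) //= (bigD1 ord0) /= 1?eq_sym // big1 ?addr0.
  rewrite !evE vsprojK // !mxE !eqxx (negPf i0) eq_sym (negPf i0) /=.
  move=> e0; have a0 := a_gt0 ord0; apply: (mulfI (lt0r_neq0 a0)).
  have -> : (a ord0)%:R * (xi 0 ord0 / (a ord0)%:R * (a i)%:R) = xi 0 ord0 * (a i)%:R.
    by field; rewrite gt_eqF.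
  by move: e0; lra.
move=> j /andP[ji j0]; rewrite evE vsprojK // !mxE (negPf ji) (negPf j0) /=.
by rewrite !mulr0 subr0 mulr0.
Qed.

(** The coordinate at [ord0] detects multiples of delta; this lifts identities on $h^0$ to the whole
    of h. *)
Lemma phi_inj0 xi eta : phi xi = phi eta -> xi 0 ord0 = eta 0 ord0 -> xi = eta.
Proof.
move=> e e0; apply/eqP; rewrite -subr_eq0.
have /phi_eq0 -> : phi (xi - eta) = 0 by rewrite linearB /= e subrr.
by rewrite !mxE e0 subrr mul0r scale0r.
Qed.

(** * Norms, roots and their signs *)

Implicit Types xi eta zeta : 'rV[R]_n.+1.

Definition qf xi : R := bil (phi xi) (phi xi).

Lemma bil_phi_sum xi eta : bil (phi xi) (phi eta) =
  \sum_i \sum_j xi 0 i / dd i * (M i j)%:~R * eta 0 j.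
Proof.
rewrite bil_phi /evx exchange_big; apply: eq_bigr => j _.
rewrite /phi ev_sum mulr_sumr; apply: eq_bigr => i _.
by rewrite evZ ev_av mulrC.
Qed.

Definition posv (xi : 'rV[R]_n.+1) := forall i, 0 <= xi 0 i.

(** A substitute for real roots: k gives integral coordinates of xi on the simple roots, and m
    integral coordinates of its coroot, $2/N$ times [phi xi] with N the norm, on the simple coroots.
    Reflections preserve these conditions. *)
Definition is_root xi := exists k m : I -> int,
  [/\ forall i, xi 0 i = (k i)%:~R, 0 < qf xi &
      forall i, xi 0 i * 2 / dd i = (m i)%:~R * qf xi].

Lemma dd_sym i j : dd j * (M i j)%:~R = dd i * (M j i)%:~R.
Proof. by have := bil_av (av i) j; rewrite bilC bil_av !ev_av. Qed.

Lemma qf_ge0 xi : 0 <= qf xi.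
Proof. exact: bil_ge0. Qed.

(** Twice the norm of xi is N times the sum of the entries of F, an integral symmetric matrix with
    even diagonal. *)
Lemma qf_integral N (k m : I -> int) xi : 0 < N ->
  (forall i, xi 0 i = (k i)%:~R) ->
  (forall i, xi 0 i * 2 / dd i = (m i)%:~R * N) ->
  exists t : int, qf xi = t%:~R * N.
Proof.
move=> N0 xk xm; pose F i j := m i * M i j * k j.
have FE i j : (F i j)%:~R * N = xi 0 i * 2 / dd i * (M i j)%:~R * xi 0 j.
  by rewrite xm xk /F !rmorphM /=; ring.
have [|i|t Ft] := @sum_sym_even _ F.
- move=> i j; apply: (intr_inj (R := R)); apply: (mulIf (lt0r_neq0 N0));
  rewrite !FE.
  have di := dd_neq0 i; have dj := dd_neq0 j.
  apply: (mulfI di); apply: (mulfI dj).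
  have -> : dd j * (dd i * (xi 0 i * 2 / dd i * (M i j)%:~R * xi 0 j)) =
     (dd j * (M i j)%:~R) * (2 * xi 0 i * xi 0 j) by field.
  by rewrite dd_sym; field; rewrite ?di ?dj.
- by exists (m i * k i); case: M_gcm => Mii _ _; rewrite /F Mii mulrAC mulr_natr.
exists t; apply: (mulfI (_ : 2 != 0 :> R)); first by rewrite pnatr_eq0.
rewrite mulrA -[2 * t%:~R]mulrC mulr_natr -rmorphMn /= -Ft rmorph_sum mulr_suml.
rewrite /qf bil_phi_sum mulr_sumr; apply: eq_bigr => i _.
rewrite rmorph_sum mulr_suml mulr_sumr; apply: eq_bigr => j _.
by rewrite FE; ring.
Qed.

Definition ppart xi : 'rV[R]_n.+1 := \row_i Num.max (xi 0 i) 0.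

Lemma ppartB xi : ppart xi - ppart (- xi) = xi.
Proof.
apply/rowP => i; rewrite !mxE /Num.max.
by case: ltP => h1; case: ltP => h2; lra.
Qed.

Lemma ppart_ge0 xi i : 0 <= ppart xi 0 i.
Proof. by rewrite mxE le_max lexx orbT. Qed.

Lemma ppart_disj xi i : ppart xi 0 i * ppart (- xi) 0 i = 0.
Proof.
by rewrite !mxE /Num.max; case: ltP => h1; case: ltP => h2; nra.
Qed.

Lemma bil_ppart_le0 xi : bil (phi (ppart xi)) (phi (ppart (- xi))) <= 0.
Proof.
rewrite bil_phi_sum; apply: sumr_le0 => i _; apply: sumr_le0 => j _.
have -> : forall x y z t : R, x / y * z * t = x * t * (z / y) by move=> *; ring.
have [<-|ij] := eqVneq i j; first by rewrite ppart_disj mul0r.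
case: M_gcm => _ Mij _; apply: mulr_ge0_le0.
  by apply: mulr_ge0; apply: ppart_ge0.
by rewrite pmulr_lle0 ?invr_gt0 ?dd_gt0 // (ler_int R _ 0) Mij.
Qed.

Lemma qf_gt0 xi i : xi != 0 -> xi 0 i = 0 -> 0 < qf xi.
Proof.
move=> xi0 xii; rewrite lt_def qf_ge0 andbT; apply: contraNneq xi0 => q0.
have /phi_eq0 e : phi xi = 0.
  by apply/eqP/negPn/negP => /bil_gt0; rewrite -/(qf xi) q0 ltxx.
have := xii; rewrite e !mxE => /eqP; rewrite !mulf_eq0 (gt_eqF (a_gt0 i)) orbF.
by rewrite invr_eq0 (gt_eqF (a_gt0 ord0)) orbF => /eqP ->; rewrite mul0r scale0r.
Qed.

(* If both parts of a root [xi] were nonzero, their norms would be nonzero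
   multiples of the norm N of [xi], by integrality of [xi] and of its coroot,
   whereas their sum is at most N because simple roots are pairwise obtuse. *)
Lemma root_sign xi : is_root xi -> posv xi \/ posv (- xi).
Proof.
move=> [k [m [xk N0 xm]]]; set N := qf xi in N0 xm.
have part (e : bool) : exists t : int, qf (ppart ((-1) ^+ e *: xi)) = t%:~R * N.
  (* The factor [c] selects the coordinates of one sign, so each part inherits the integrality of xi
     and of its coroot. *)
  pose c i : int := if 0 < (-1) ^+ e * xi 0 i then (-1) ^+ e else 0.
  apply: (@qf_integral N (fun i => c i * k i) (fun i => c i * m i)) => // i.
    rewrite !mxE /c rmorphM /= -xk; case: (ltP 0 ((-1)^+e * xi 0 i)) => h.
      by rewrite rmorphXn /= rmorphN1.
    by rewrite mul0r.
  rewrite !mxE /c rmorphM /= -[RHS]mulrA -xm; case: (ltP 0 ((-1)^+e * xi 0 i)) => h.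
    by rewrite rmorphXn /= rmorphN1 !mulrA.
  by rewrite !mul0r.
have [t1] := part false; have [t2] := part true.
rewrite expr0 scale1r expr1 scaleN1r => e2 e1.
case: (pselect (posv xi)) => [|npos]; [by left|right=> i].
rewrite mxE oppr_ge0; case: leP => // xi_gt0; exfalso.
have [j xj] : exists j, xi 0 j < 0.
  apply: contrapT => nex; apply: npos => j; rewrite leNgt; apply/negP => ?.
  by apply: nex; exists j.
have q1 : 0 < qf (ppart xi).
  apply: (@qf_gt0 _ j); last by rewrite mxE maxEle (ltW xj).
  by apply: contraTneq xi_gt0 => /rowP/(_ i); rewrite !mxE -leNgt => e;
    rewrite -[leRHS]e le_max lexx.
have q2 : 0 < qf (ppart (- xi)).
  apply: (@qf_gt0 _ i); last by rewrite !mxE maxEle oppr_le0 (ltW xi_gt0).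
  apply: contraTneq xj => /rowP/(_ j); rewrite !mxE -leNgt -oppr_le0 => e.
  by rewrite -[leRHS]e le_max lexx.
have ge (t : int) : 0 < t%:~R * N -> N <= t%:~R * N.
  rewrite pmulr_lgt0 // ltr0z => t0; rewrite ler_peMl ?(ltW N0) //.
  by rewrite ler1z -gtz0_ge1.
have : N = qf (ppart xi) + qf (ppart (- xi)) - 2 * bil (phi (ppart xi)) (phi (ppart (- xi))).
  rewrite {1}/N -{1}(ppartB xi) /qf linearB /= !bilBl !bilBr.
  by rewrite (bilC (phi (ppart (- xi))) (phi (ppart xi))); ring.
have := bil_ppart_le0 xi; move: q1 q2; rewrite e1 e2 => /ge h1 /ge h2;
  move: N0 h1 h2; lra.
Qed.

Lemma evx_lin x k xi eta : evx x (k *: xi + eta) = k * evx x xi + evx x eta.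
Proof. by rewrite -!bil_phi linearP bilDr bilZr. Qed.

Definition rr i xi := xi - evx (av i) xi *: al i.

Lemma rr_lin i k xi eta : rr i (k *: xi + eta) = k *: rr i xi + rr i eta.
Proof.
by rewrite /rr evx_lin scalerDl scalerBr scalerA opprD addrACA.
Qed.

Lemma phi_rr i xi : phi (rr i xi) = act (s i) (phi xi).
Proof.
rewrite act_s_val ev_phi /rr.
by rewrite [LHS]linearB [X in _ - X]linearZ /= phi_al scalerA.
Qed.

Lemma rr_coord i j xi : j != i -> rr i xi 0 j = xi 0 j.
Proof. by move=> /negPf ji; rewrite !mxE eqxx ji mulr0 subr0. Qed.

Lemma evx_delta x : evx x delta = 0.
Proof. by rewrite -bil_phi phi_delta bilC bil0l. Qed.

Lemma rr_delta i : rr i delta = delta.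
Proof. by rewrite /rr evx_delta scale0r subr0. Qed.

Lemma rr_al i : rr i (al i) = - al i.
Proof.
by rewrite /rr evx_al ev_av_diag scaler_nat mulr2n opprD addNKr.
Qed.

Lemma rrK i : involutive (rr i).
Proof.
move=> xi; rewrite {2}/rr -[- (_ *: _)]scaleNr addrC rr_lin rr_al /rr.
by rewrite scaleNr scalerN opprK addrC subrK.
Qed.

Lemma qf_rr i xi : qf (rr i xi) = qf xi.
Proof. by rewrite /qf phi_rr bil_act. Qed.

Lemma qf_al i : qf (al i) = 2 / dd i.
Proof.
by rewrite /qf phi_al bilZl bilZr bil_av ev_av_diag mulKf ?dd_neq0 // mulrC.
Qed.

Lemma root_al i : is_root (al i).
Proof.
exists (fun j => (j == i)%:R), (fun j => (j == i)%:R); split=> [j||j].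
- by rewrite mxE eqxx /=; case: eqP.
- by rewrite qf_al divr_gt0 // dd_gt0.
- rewrite mxE eqxx qf_al /=; case: eqP => [->|_]; first by rewrite mulrA.
  by rewrite !mul0r.
Qed.

Lemma root_rr i xi : is_root xi -> is_root (rr i xi).
Proof.
move=> [k [m [xk N0 xm]]].
have evk : evx (av i) xi = (\sum_j k j * M i j)%:~R.
  rewrite /evx rmorph_sum; apply: eq_bigr => j _.
  by rewrite ev_av xk rmorphM.
exists (fun j => k j - (j == i)%:R * \sum_j k j * M i j).
exists (fun j => m j - (j == i)%:R * \sum_j m j * M j i).
rewrite qf_rr; split=> // j; rewrite !mxE eqxx /=.
  by rewrite evk xk rmorphB rmorphM /= mulrC; case: (j == i).
rewrite rmorphB /= [RHS]mulrBl -xm !mulrBl; congr (_ - _).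
case: eqP => [->|_]; last by rewrite mulr0 !mul0r.
rewrite mulr1 mul1r rmorph_sum mulr_suml /evx mulr_suml mulr_suml;
  apply: eq_bigr => l _.
rewrite rmorphM /= [RHS]mulrAC -xm ev_av.
have di := dd_neq0 i; have dl := dd_neq0 l.
apply: (mulfI di); apply: (mulfI dl).
have -> : dd l * (dd i * (xi 0 l * (M i l)%:~R * 2 / dd i)) =
   (dd l * (M i l)%:~R) * (2 * xi 0 l) by field.
by rewrite dd_sym; field.
Qed.

Lemma root_neq0 xi : is_root xi -> xi != 0.
Proof.
by move=> [k [m [_ + _]]]; apply: contraTneq => ->; rewrite /qf linear0 bil0l ltxx.
Qed.

(** * Words in the simple reflections, exchange and reduced words *)

Definition rw (l : seq I) xi := foldr rr xi l.

Lemma rw_cat l1 l2 xi : rw (l1 ++ l2) xi = rw l1 (rw l2 xi).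
Proof. exact: foldr_cat. Qed.

Lemma rw_lin l k xi eta : rw l (k *: xi + eta) = k *: rw l xi + rw l eta.
Proof. by elim: l => //= i l ->; rewrite rr_lin. Qed.

Lemma rw0 l : rw l 0 = 0.
Proof. by have := rw_lin l (-1) 0 0; rewrite addr0 scaler0 scaleN1r addNr. Qed.

Lemma rwZ l k xi : rw l (k *: xi) = k *: rw l xi.
Proof. by have := rw_lin l k xi 0; rewrite rw0 !addr0. Qed.

Lemma rwN l xi : rw l (- xi) = - rw l xi.
Proof. by rewrite -scaleN1r rwZ scaleN1r. Qed.

Lemma rw_delta l : rw l delta = delta.
Proof. by elim: l => //= i l ->; rewrite rr_delta. Qed.

Lemma rwK l : cancel (rw l) (rw (rev l)).
Proof.
by elim: l => //= i l IH xi; rewrite rev_cons -cats1 rw_cat /= rrK.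
Qed.

Lemma rwVK l : cancel (rw (rev l)) (rw l).
Proof. by rewrite -{2}(revK l); apply: rwK. Qed.

Lemma root_rw l xi : is_root xi -> is_root (rw l xi).
Proof. by move=> rx; elim: l => //= i l; apply: root_rr. Qed.

Lemma phi_rw l xi : phi (rw l xi) = act (sw l) (phi xi).
Proof.
elim: l => [|i l IH]; first by rewrite sw_nil act1 id_lfunE.
by rewrite sw_cons actM -IH /= phi_rr.
Qed.

Lemma rw_coord l j xi : j \notin l -> rw l xi 0 j = xi 0 j.
Proof.
elim: l => //= i l IH; rewrite inE negb_or => /andP[ji jl].
by rewrite rr_coord // IH.
Qed.

Lemma sw_eq l l' : rw l =1 rw l' -> sw l = sw l'.
Proof.
by move=> e; apply: act_eq => i; rewrite !av_phi !linearZ /= -!phi_rw e.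
Qed.

(** The word acts by isometries, so $c^2$ is the ratio of the norms of $\alpha_i$ and $\alpha_j$,
    and the reflection of i is conjugated to that of j. *)
Lemma rw_exchange l i j c : c != 0 -> rw l (al i) = c *: al j ->
  forall xi, rr j (rw l xi) = rw l (rr i xi).
Proof.
move=> c0 e xi; rewrite {2}/rr addrC -scaleNr rw_lin e scalerA mulNr scaleNr addrC.
congr (_ - _ *: _).
have di := dd_neq0 i; have dj := dd_neq0 j.
have e1 : c *: phi (al j) = act (sw l) (phi (al i)) by rewrite -phi_rw e linearZ.
have : qf (al i) = c * c * qf (al j).
  by rewrite /qf -(bil_act (sw l)) -e1 bilZl bilZr mulrA.
rewrite !qf_al => e2.
have e3 : c * c * dd i = dd j.
  have -> : c * c * dd i = c * c * (2 / dd j) * (dd i * dd j / 2) by field.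
  by rewrite -e2; field.
rewrite -!bil_phi phi_rw (av_phi j) bilZl.
have -> : phi (al j) = c^-1 *: act (sw l) (phi (al i)).
  by rewrite -e1 scalerA mulVf // scale1r.
rewrite bilZl bil_act phi_al bilZl -e3; field.
by rewrite c0 di.
Qed.

(** Read the word from the right up to the first letter j that makes the root negative. Since $s_j$
    changes only the coordinate at j, the root was then a multiple of $\alpha_j$. *)
Lemma neg_split l xi : is_root xi -> posv xi -> posv (- rw l xi) ->
  exists l1 j l2 c, [/\ l = l1 ++ j :: l2, 0 < c & rw l2 xi = c *: al j].
Proof.
move=> rx px; elim: l => [|i l IH] /= neg.
  case/negP: (root_neq0 rx); apply/eqP/rowP => j; rewrite mxE; apply/eqP.
  by rewrite eq_le px andbT; have := neg j; rewrite mxE oppr_ge0.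
have [pos|/IH[l1 [j [l2 [c [-> c0 e]]]]]] := root_sign (root_rw l rx); last first.
  by exists (i :: l1), j, l2, c.
exists [::], i, l, (rw l xi 0 i); have e : rw l xi = rw l xi 0 i *: al i.
  apply/rowP => j; rewrite !mxE eqxx /=; have [->|ji] := eqVneq j i;
    first by rewrite mulr1.
  rewrite mulr0; apply/eqP; rewrite eq_le pos andbT -oppr_ge0.
  by have := neg j; rewrite mxE rr_coord.
split=> //; rewrite lt_def pos andbT;
  apply: contraTneq (root_neq0 (root_rw l rx)) => z.
by rewrite negbK e z scale0r.
Qed.

(** Words are compared through [rw], that is in the affine group, and only with words whose letters
    satisfy P. *)
Definition reduced (P : pred I) (l : seq I) : Prop :=
  forall l', all P l' -> rw l' =1 rw l -> (size l <= size l')%N.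

(** Otherwise [neg_split] and [rw_exchange] allow two letters to be deleted, the last one and the
    letter j found inside l. *)
Lemma reduced_pos (P : pred I) l i : all P (rcons l i) -> reduced P (rcons l i) ->
  posv (rw l (al i)).
Proof.
move=> Pl red; have [//|neg] := root_sign (root_rw l (root_al i)); exfalso.
have [|l1 [j [l2 [c [el c0 e]]]]] := neg_split (root_al i) _ neg.
  by move=> j; rewrite mxE; apply: ler0n.
have := red (l1 ++ l2); rewrite size_rcons el !size_cat /= addnS => h.
suff : ((size l1 + size l2).+2 <= size l1 + size l2)%N by rewrite ltnNge leqnSn.
apply: h.
  by move: Pl; rewrite el -cats1 !all_cat /= => /andP[/andP[-> /andP[_ ->]]].
move=> xi; rewrite -cats1 !rw_cat /= (rw_exchange (lt0r_neq0 c0) e).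
by rewrite rrK.
Qed.

Lemma reduced_catl P l1 l2 : all P l2 -> reduced P (l1 ++ l2) -> reduced P l1.
Proof.
move=> P2 red l P1 e; have := red (l ++ l2); rewrite !size_cat leq_add2r; apply.
  by rewrite all_cat P1.
by move=> xi; rewrite !rw_cat e.
Qed.

Lemma reduced_catr P l1 l2 : all P l1 -> reduced P (l1 ++ l2) -> reduced P l2.
Proof.
move=> P1 red l P2 e; have := red (l1 ++ l); rewrite !size_cat leq_add2l; apply.
  by rewrite all_cat P1.
by move=> xi; rewrite !rw_cat e.
Qed.

Lemma reduced_rev P l : reduced P l -> reduced P (rev l).
Proof.
move=> red l' P' e; rewrite size_rev -(size_rev l'); apply: red;
  first by rewrite all_rev.
by move=> xi; rewrite -{1}(rwK l xi) -e rwK.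
Qed.

Lemma exists_reduced P l : all P l ->
  exists l', [/\ all P l', reduced P l' & rw l' =1 rw l].
Proof.
elim: {l}(size l).+1 {-2}l (ltnSn (size l)) => // k IH l lk Pl.
case: (pselect (reduced P l)) => [|nred]; first by exists l.
have [l' [Pl' el lt]] : exists l', [/\ all P l', rw l' =1 rw l & (size l' < size l)%N].
  apply: contrapT => nex; apply: nred => l' Pl' e; rewrite leqNgt; apply/negP => lt.
  by apply: nex; exists l'.
have [|l2 [P2 r2 e2]] := IH l' _ Pl'; first exact: leq_trans lt lk.
by exists l2; split=> // xi; rewrite e2 el.
Qed.

(** * The finite Weyl group as the group of words in the finite nodes *)

Hypothesis labelling : good_labelling R M a.

Definition refl_word (l : seq I) : 'End('rV[R]_n.+1) :=
  foldr (fun i g => refl R M i \o g)%VF \1%VF l.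

Lemma refl_word_cat l1 l2 : refl_word (l1 ++ l2) = (refl_word l1 \o refl_word l2)%VF.
Proof.
by elim: l1 => [|i l1 IH] /=; rewrite ?comp_lfun1l // IH comp_lfunA.
Qed.

Lemma refl_subgroup_word (J : set I) g : refl_subgroup M J g ->
  exists2 l, all (fun i => `[<J i>]) l & g = refl_word l.
Proof.
pose G := [set g : 'End('rV[R]_n.+1) | exists2 l, all (fun i => `[<J i>]) l & g = refl_word l].
have invol i : (refl R M i \o refl R M i)%VF = \1%VF.
  apply/lfunP => x; rewrite comp_lfunE id_lfunE !reflE !pairing_alpha.
  by apply/rowP => j; case: M_gcm => Mii _ _; rewrite !mxE Mii; ring.
move/(_ G); apply; split; last by move=> _ [i Ji <-]; exists [:: i];
  rewrite /= ?asboolT ?comp_lfun1r.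
split; first by exists [::].
  by move=> _ _ [l1 J1 ->] [l2 J2 ->]; exists (l1 ++ l2);
    rewrite ?all_cat ?J1 // refl_word_cat.
move=> _ [l Jl ->]; exists (rev l); first by rewrite all_rev.
have e : (refl_word (rev l) \o refl_word l)%VF = \1%VF.
  elim: {Jl} l => [|i l IH]; first by rewrite comp_lfun1l.
  rewrite rev_cons -cats1 refl_word_cat /= comp_lfun1r -comp_lfunA.
  by rewrite [X in (_ \o X)%VF]comp_lfunA invol comp_lfun1l.
have e' : (refl_word l \o refl_word (rev l))%VF = \1%VF.
  elim: {Jl e} l => [|i l IH]; first by rewrite comp_lfun1l.
  rewrite rev_cons -cats1 refl_word_cat /= comp_lfun1r -comp_lfunA.
  by rewrite [X in (_ \o X)%VF]comp_lfunA IH comp_lfun1l invol.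
(* In general [^-1%VF] is only a pseudo-inverse; injectivity makes it a true one. *)
have ker : lker (refl_word l) == 0%VS.
  apply/lker0P; apply: (can_inj (g := refl_word (rev l))) => x.
  by rewrite -comp_lfunE e id_lfunE.
by rewrite -[LHS]comp_lfun1r -e' comp_lfunA (lker0_compVf ker) comp_lfun1l.
Qed.

Lemma act_sw_val l x : vsval (act (sw l) x) = refl_word l (vsval x).
Proof.
elim: l => [|i l IH]; first by rewrite sw_nil act1 !id_lfunE.
rewrite sw_cons actM /= comp_lfunE -IH (act_s Wfin) clE //.
by rewrite refl_h0 // subvsP.
Qed.

(** The surjectivity contained in [labelling] supplies a preimage that is a word in the finite
    nodes. *)
Lemma in_parabolic_full w : in_parabolic s [set~ ord0]%SET w.
Proof.
have : @finite_Weyl R n M a (act w) by case: (act_bij Wfin) => + _ _; apply.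
case: labelling => _ _ surj /surj[g /refl_subgroup_word[l Jl ->] e].
exists l; first by apply: sub_all Jl => i /asboolP i0; rewrite /= !inE; exact: i0.
apply: act_inj; rewrite -e; apply/lfunP => x; apply: val_inj => /=.
by rewrite clE -act_sw_val ?subvsP.
Qed.

(** * Positive vectors, regularity of rho and descents *)

Definition vpos (v : V) : Prop :=
  exists xi, [/\ posv xi, xi 0 ord0 = 0, v != 0 & phi xi = v].

Definition coherent (v : V) : Prop := vpos v \/ vpos (- v).

Lemma coherentN v : coherent v -> coherent (- v).
Proof. by case=> h; [right; rewrite opprK | left]. Qed.

Lemma vposZ c v : 0 < c -> vpos v -> vpos (c *: v).
Proof.
move=> c0 [xi [px x0 v0 xv]]; exists (c *: xi); split.
- by move=> i; rewrite mxE mulr_ge0 // ltW.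
- by rewrite mxE x0 mulr0.
- by rewrite scaler_eq0 negb_or (gt_eqF c0).
- by rewrite linearZ /= xv.
Qed.

Lemma coherentZ c v : c != 0 -> coherent v -> coherent (c *: v).
Proof.
move=> c0; wlog cp : c v c0 / 0 < c => [H cv|].
  have [cp|cn] := ltP 0 c; first exact: H.
  rewrite -[c]opprK scaleNr -scalerN; apply: H; rewrite ?oppr_eq0 //.
    by rewrite oppr_gt0 lt_def eq_sym c0.
  exact: coherentN.
by case=> h; [left | right; rewrite -scalerN]; apply: vposZ.
Qed.

Lemma vpos_anti v : vpos v -> vpos (- v) -> False.
Proof.
move=> [xi [px x0 v0 xv]] [eta [pe e0 _ ev]].
have e : xi + eta = 0.
  by apply: phi_inj0;
    rewrite ?linearD /= ?xv ?ev ?subrr ?linear0 // !mxE x0 e0 addr0.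
case/negP: v0; rewrite -xv (_ : xi = 0) ?linear0 //; apply/rowP => i;
  rewrite [RHS]mxE.
apply/eqP; rewrite eq_le px andbT.
by have /rowP/(_ i) := e; rewrite !mxE => /eqP; rewrite addr_eq0 => /eqP ->;
  rewrite oppr_le0.
Qed.

(** All coordinates other than that at j are unchanged by $s_j$, hence both nonnegative and
    nonpositive. *)
Lemma vpos_flip j v : j != ord0 -> vpos v -> vpos (- act (s j) v) ->
  exists2 c, 0 < c & v = c *: av j.
Proof.
move=> j0 [xi [px x0 v0 xv]] [eta [pe e0 _ ev]].
have e : rr j xi = - eta.
  apply: phi_inj0; first by rewrite phi_rr linearN /= ev opprK xv.
  by rewrite rr_coord 1?eq_sym // x0 mxE e0 oppr0.
have xj : xi = xi 0 j *: al j.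
  apply/rowP => i; rewrite !mxE eqxx /=; have [->|ij] := eqVneq i j;
    first by rewrite mulr1.
  rewrite mulr0; apply/eqP; rewrite eq_le px andbT -(rr_coord xi ij) e mxE oppr_le0.
  exact: pe.
exists (xi 0 j / dd j); last by rewrite -xv {1}xj linearZ /= phi_al scalerA.
rewrite divr_gt0 ?dd_gt0 // lt_def px andbT; apply: contraNneq v0 => z.
by rewrite -xv xj z scale0r linear0.
Qed.

Lemma act_neq0 w v : v != 0 -> act w v != 0.
Proof. by apply: contraNneq => e; rewrite -(actK w v) e linear0. Qed.

Lemma finite_root w i : i != ord0 -> exists xi,
  [/\ is_root xi, xi 0 ord0 = 0 & phi xi = act w (phi (al i))].
Proof.
move=> i0; have [l l0 ->] := in_parabolic_full w; exists (rw l (al i)); split.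
- exact/root_rw/root_al.
- rewrite rw_coord; first by rewrite mxE eq_sym (negPf i0).
  by apply/negP => /(allP l0); rewrite /= !inE eqxx.
- exact: phi_rw.
Qed.

Lemma root_coherent xi : is_root xi -> xi 0 ord0 = 0 -> coherent (phi xi).
Proof.
move=> rx x0.
have v0 : phi xi != 0.
  by apply: contraNneq (root_neq0 rx) => /phi_eq0 ->; rewrite x0 mul0r scale0r.
have [p|p] := root_sign rx; [left; exists xi | right; exists (- xi)]; split=> //.
- by rewrite mxE x0 oppr0.
- by rewrite oppr_eq0.
- by rewrite linearN.
Qed.

Lemma finite_coherent w i : i != ord0 -> coherent (act w (phi (al i))).
Proof. by move=> i0; have [xi [rx x0 <-]] := finite_root w i0;
  apply: root_coherent. Qed.

Lemma finite_coherent_av w i : i != ord0 -> coherent (act w (av i)).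
Proof.
by move=> i0; rewrite av_phi linearZ; apply: coherentZ; rewrite ?dd_neq0 //;
  apply: finite_coherent.
Qed.

Lemma vpos_phi_al j : j != ord0 -> vpos (phi (al j)).
Proof.
move=> j0; exists (al j); split=> //; last first.
  by rewrite phi_al scaler_eq0 invr_eq0 (negPf (dd_neq0 j)) /= av_neq0.
- by rewrite mxE eq_sym (negPf j0).
- by move=> i; rewrite mxE ler0n.
Qed.

Lemma vpos_av j : j != ord0 -> vpos (av j).
Proof. by move=> j0; rewrite av_phi; apply: vposZ (dd_gt0 j) (vpos_phi_al j0). Qed.

Definition dominant (x : V) := forall j, j != ord0 -> 0 <= ev x j.
Definition regular (x : V) := forall j, j != ord0 -> 0 < ev x j.

Lemma dominant_vpos x v : dominant x -> vpos v -> 0 <= bil x v.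
Proof.
move=> dx [xi [px x0 _ <-]]; rewrite bil_phi; apply: sumr_ge0 => i _.
have [->|i0] := eqVneq i ord0; first by rewrite x0 mul0r.
by rewrite mulr_ge0 ?px ?dx.
Qed.

Lemma regular_vpos x v : regular x -> vpos v -> 0 < bil x v.
Proof.
move=> dx [xi [px x0 v0 xv]]; rewrite lt_def dominant_vpos ?andbT; last first.
- by exists xi.
- by move=> j j0; apply/ltW/dx.
rewrite -xv bil_phi; apply: contraNneq v0 => e;
  rewrite -xv (_ : xi = 0) ?linear0 //.
have ge i : 0 <= xi 0 i * ev x i.
  have [->|i0] := eqVneq i ord0; first by rewrite x0 mul0r.
  by rewrite mulr_ge0 ?px ?ltW ?dx.
apply/rowP => i; rewrite [RHS]mxE; have [->//|i0] := eqVneq i ord0.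
move/eqP: e; rewrite psumr_eq0 // => /allP/(_ i);
  rewrite mem_index_enum => /(_ isT) /=.
by rewrite mulf_eq0 (gt_eqF (dx _ i0)) orbF => /eqP.
Qed.

(* The classical argument that s_j permutes the positive roots other than
   the multiples of alpha_j. *)
Lemma regular_sum (S : seq V) : uniq S ->
  (forall j v, j != ord0 -> v \in S -> act (s j) v \in S) ->
  (forall v, v \in S -> coherent v) ->
  (forall j, j != ord0 -> exists2 v, v \in S & exists2 c, 0 < c & v = c *: av j) ->
  regular (\sum_(v <- S | `[<vpos v>]) v).
Proof.
move=> uS Sact Scoh Sav j j0; set x := \sum_(v <- S | _) v.
have actK_s v : act (s j) (act (s j) v) = v by rewrite -actM sK act1 id_lfunE.
have permS : perm_eq S [seq act (s j) v | v <- S].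
  apply: uniq_perm => //; first by rewrite map_inj_uniq //; apply: can_inj actK_s.
  move=> v; apply/idP/mapP => [Sv|[u Su ->]]; last exact: Sact.
  by exists (act (s j) v); rewrite ?actK_s // Sact.
pose t v : R := (`[<vpos v>]%:R - `[<vpos (act (s j) v)>]%:R) * ev v j.
have xt : 2 * ev x j = \sum_(v <- S) t v.
  have e : ev (x - act (s j) x) j = 2 * ev x j.
    by rewrite act_s_val opprB addrC subrK evZ ev_av_diag mulrC.
  rewrite -e evB /t; under [RHS]eq_bigr do rewrite mulrBl.
  rewrite sumrB; congr (_ - _).
    rewrite /x ev_sum big_mkcond; apply: eq_bigr => v _.
    by case: asboolP; rewrite ?mul1r ?mul0r.
  rewrite /x linear_sum ev_sum (perm_big _ permS) big_map big_mkcond;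
    apply: eq_bigr => v _ /=.
  by rewrite actK_s; case: asboolP; rewrite ?mul1r ?mul0r.
have t_ge0 v : v \in S -> 0 <= t v.
  move=> Sv; rewrite /t; case: asboolP => Pv; case: asboolP => Psv.
  - by rewrite subrr mul0r.
  - have [//|nv] := Scoh _ (Sact _ _ j0 Sv).
    by have [c c0 ->] := vpos_flip j0 Pv nv;
      rewrite subr0 mul1r evZ ev_av_diag mulr_ge0 // ltW.
  - have [//|nv] := Scoh _ Sv.
    have [|c c0 e] := vpos_flip j0 nv; first by rewrite linearN opprK.
    by rewrite sub0r mulN1r -evN e evZ ev_av_diag mulr_ge0 // ltW.
  - by rewrite subrr mul0r.
have [u Su [c c0 uc]] := Sav j j0.
have tu : 0 < t u.
  have Pu : vpos u by rewrite uc; apply: vposZ (vpos_av j0).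
  rewrite /t; case: asboolP => // _; case: asboolP => [Psu|_].
    case: (vpos_anti Pu); move: Psu.
    by rewrite uc linearZ /= act_s_av scalerN.
  by rewrite subr0 mul1r uc evZ ev_av_diag mulr_gt0.
suff : 0 < 2 * ev x j by rewrite pmulr_rgt0.
rewrite xt (bigD1_seq u) //= ltr_pwDl //.
by rewrite big_seq_cond; apply: sumr_ge0 => v /andP[Sv _]; apply: t_ge0.
Qed.

Lemma positive_corootP v : coherent v -> `[<positive_coroot M v>] = `[<vpos v>].
Proof.
move=> cv; have v0 : v != 0.
  by case: cv => -[xi [_ _]]; rewrite ?oppr_eq0.
apply: asbool_equiv_eq; split=> [[c c0 e]|[xi [px x0 _ <-]]].
  exists (\row_i if i == ord0 then 0 else c i * dd i); split=> //.
  - by move=> i; rewrite mxE; case: ifP => // _; rewrite mulr_ge0 // ltW // dd_gt0.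
  - by rewrite mxE eqxx.
  - rewrite e /phi (bigD1 ord0) //= mxE eqxx mul0r scale0r add0r.
    by apply: eq_bigr => i /negPf i0; rewrite mxE i0 mulfK ?dd_neq0.
exists (fun i => xi 0 i / dd i); first by move=> i;
  rewrite divr_ge0 // ltW // dd_gt0.
by rewrite /phi (bigD1 ord0) //= x0 mul0r scale0r add0r.
Qed.

Local Notation rho := (rhov M act).

Lemma coroot_mem v : v \in coroots M act -> exists w i, i != ord0 /\ v = act w (av i).
Proof.
rewrite mem_undup => /allpairsPdep[w [i [_ +]]].
by rewrite mem_filter => /andP[i0 _] ->; exists w, i.
Qed.

Lemma mem_coroot w i : i != ord0 -> act w (av i) \in coroots M act.
Proof.
move=> i0; rewrite mem_undup; apply/allpairsPdep; exists w, i.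
by rewrite mem_enum mem_filter mem_enum i0.
Qed.

Lemma rho_regular : regular rho.
Proof.
have coh v : v \in coroots M act -> coherent v.
  by move=> /coroot_mem[w [i [i0 ->]]]; apply: finite_coherent_av.
have e : rho = 2^-1 *: \sum_(v <- coroots M act | `[<vpos v>]) v.
  rewrite /rhov; congr (_ *: _); rewrite big_seq_cond [RHS]big_seq_cond.
  by apply: eq_bigl => v; case: (boolP (v \in _)) => //= /coh/positive_corootP ->.
move=> j j0; rewrite e evZ mulr_gt0 ?invr_gt0 //; move: j j0;
  apply: regular_sum => //.
- exact: undup_uniq.
- by move=> j v j0 /coroot_mem[w [i [i0 ->]]]; rewrite -actM mem_coroot.
- move=> j j0; exists (av j); last by exists 1; rewrite ?scale1r.
  by have := mem_coroot 1%g j0; rewrite act1 id_lfunE.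
Qed.

(** Take for j the last letter of a word of y that is reduced among words in J, and apply
    [reduced_pos]. *)
Lemma parabolic_descent (J : {set I}) y : ord0 \notin J -> in_parabolic s J y ->
  y != 1%g -> exists2 j, j \in J & exists xi, [/\ posv xi, xi != 0,
    forall i, i \notin J -> xi 0 i = 0 & phi xi = - act y (phi (al j))].
Proof.
move=> J0 [l0 Jl0 ->]; have [l [Jl red /sw_eq <-]] := exists_reduced Jl0.
elim/last_ind: l Jl red => [|l j _] Jl red; first by rewrite sw_nil eqxx.
move=> _; move: (Jl); rewrite all_rcons => /andP[Jj Jl'].
exists j => //; exists (rw l (al j)); split.
- exact: reduced_pos Jl red.
- exact/root_neq0/root_rw/root_al.
- move=> i iJ; rewrite rw_coord; last by apply: contra iJ => /(allP Jl').
  by rewrite mxE (negPf (_ : i != j)) //; apply: contraNneq iJ => ->.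
- rewrite -phi_rw -cats1 rw_cat /= rr_al rwN linearN /= opprK //.
Qed.

Lemma exists_descent w : w != 1%g ->
  exists2 i, i != ord0 & vpos (- act w (phi (al i))).
Proof.
move=> w1; have K0 : ord0 \notin [set~ ord0 : I]%SET by rewrite !inE eqxx.
have [j] := parabolic_descent K0 (in_parabolic_full w) w1.
rewrite !inE => j0 [xi [px xi0 xJ e]]; exists j => //; exists xi; split=> //.
  by apply: xJ; rewrite !inE eqxx.
by rewrite oppr_eq0; apply: act_neq0; have [? []] := vpos_phi_al j0.
Qed.

Lemma s_neq1 i : s i != 1%g.
Proof.
apply/eqP => e; have := act_s_av i; rewrite e act1 id_lfunE => /eqP.
by rewrite -addr_eq0 -mulr2n -scaler_nat scaler_eq0 pnatr_eq0 (negPf (av_neq0 i)).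
Qed.

Lemma act_av_neq0 w i : act w (av i) != 0.
Proof. exact/act_neq0/av_neq0. Qed.

(* A reflection of the finite Weyl group, here a conjugate of [s ord0], makes
   some simple root negative, so its root is coherent with the base. *)
Lemma reflection_descent w k : exists i c xi,
  [/\ i != ord0, c = bil (act w (av k)) (phi (al i)) / dd k,
      vpos (phi xi) & c *: act w (av k) = phi (al i) + phi xi].
Proof.
have r1 : (w * s k * w^-1)%g != 1%g.
  by rewrite -(inj_eq (mulIg w)) mulgKV mul1g -{2}(mulg1 w) (inj_eq (mulgI w)) s_neq1.
have [i i0 vi] := exists_descent r1; have [xi [px x0 v0 e]] := vi.
exists i, (bil (act w (av k)) (phi (al i)) / dd k), xi; split=> //;
  first by rewrite e.
by rewrite e act_conj_s opprB addrC subrK.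
Qed.

Lemma vposD u v : vpos u -> vpos v -> vpos (u + v).
Proof.
move=> vu vv; have [xi [px x0 _ xu]] := vu; have [eta [pe e0 _ ev]] := vv.
exists (xi + eta); split=> [i|||].
- by rewrite mxE addr_ge0.
- by rewrite mxE x0 e0 addr0.
- apply/eqP => uv0; apply: (vpos_anti vu); suff <- : v = - u by [].
  by apply/eqP; rewrite -addr_eq0 addrC uv0.
- by rewrite linearD /= xu ev.
Qed.

(** Here k may be [ord0]: a nonzero multiple of the vector is a sum of two positive vectors by
    [reflection_descent]. *)
Lemma coherent_av w k : coherent (act w (av k)).
Proof.
have [i [c [xi [i0 _ vxi e]]]] := reflection_descent w k.
have vsum := vposD (vpos_phi_al i0) vxi.
have c0 : c != 0.
  apply/eqP => c0; have [? [_ _ + _]] := vsum.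
  by rewrite -e c0 scale0r eqxx.
have -> : act w (av k) = c^-1 *: (c *: act w (av k)).
  by rewrite scalerA mulVf // scale1r.
by apply: coherentZ; rewrite ?invr_eq0 // e; left.
Qed.

(** * Ascents, as tested in [pi_op], and a height on the finite group *)

Definition ascent (w : gT) (i : I) : bool := 0 < ev (act w^-1%g rho) i.
Local Notation p := ascent.

Lemma ascentE w i : p w i = (0 < bil rho (act w (av i))).
Proof.
have -> : bil rho (act w (av i)) = dd i * ev (act w^-1%g rho) i.
  by rewrite bilC bil_actl bilC bil_av.
by rewrite pmulr_rgt0 ?dd_gt0.
Qed.

Lemma ascent_vpos w i : p w i = `[<vpos (act w (av i))>].
Proof.
rewrite ascentE; case: asboolP => [/(regular_vpos rho_regular) //|nv].
have [//|/(regular_vpos rho_regular)] := coherent_av w i.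
by rewrite bilNr oppr_gt0 => /lt_geF lt; apply/negbTE;
  rewrite -leNgt ltW // ltNge lt.
Qed.

Lemma ascent_ge0 w i : p w i = (0 <= bil rho (act w (av i))).
Proof.
rewrite ascentE lt_def andb_idl // => _.
have [/(regular_vpos rho_regular)/gt_eqF -> //|/(regular_vpos rho_regular)] := coherent_av w i.
by rewrite bilNr oppr_gt0 => /lt_eqF ->.
Qed.

Lemma ascent_s w i : p (w * s i)%g i = ~~ p w i.
Proof.
rewrite ascentE actM act_s_av linearN bilNr oppr_gt0 /=.
by rewrite ascent_ge0 -ltNge.
Qed.

Lemma conj_s w i j c : act w (av i) = c *: av j -> (s j * w = w * s i)%g.
Proof.
move=> e; suff <- : (w * s i * w^-1 = s j)%g by rewrite mulgKV.
have c0 : c != 0.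
  by apply: contra_neq (act_av_neq0 w i); rewrite e => ->; rewrite scale0r.
have di : dd i = c * c * dd j.
  by rewrite {1}/dd -(bil_act w) e bilZl bilZr bil_av ev_av_diag; field.
have k x : bil (c *: av j) x / dd i * c = ev x j.
  by rewrite di bilZl bilC bil_av; field; rewrite c0 dd_neq0.
by apply: act_inj; apply/lfunP => x; rewrite act_conj_s act_s_val e scalerA k.
Qed.

(** By [vpos_flip], $s_j$ changes the sign of a coherent vector only if it is a multiple of the
    coroot of j, the case treated by [conj_s]. *)
Lemma ascent_left w i j : j != ord0 ->
  (s j * w = w * s i)%g \/ p (s j * w)%g i = p w i.
Proof.
move=> j0; rewrite !ascent_vpos actM.
case: (pselect (exists c, act w (av i) = c *: av j)) => [[c /conj_s]|nc];
  first by left.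
right; apply: asbool_equiv_eq; split=> [v|v].
  have [//|nv] := coherent_av w i; case: nc.
  have [|c _ e] := vpos_flip j0 nv; first by rewrite linearN opprK.
  by exists (- c); rewrite scaleNr -e opprK.
have := coherent_av (s j * w)%g i; rewrite actM => -[//|nv]; case: nc.
by have [c _ e] := vpos_flip j0 v nv; exists c.
Qed.

(** A real substitute for the length, increasing along finite ascents by [height_fun_s]; [height]
    turns it into a natural number by ranking. *)
Definition height_fun (w : gT) : R := - bil rho (act w rho).
Definition height (w : gT) : nat := #|[pred x | height_fun x < height_fun w]|.
Local Notation H := height_fun.
Local Notation h := height.

Lemma height_lt x y : (h x < h y)%N = (H x < H y).
Proof.
have le u v : H u <= H v -> (h u <= h v)%N.
  move=> uv; apply/subset_leq_card/fintype.subsetP => z; rewrite !inE => zu.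
  exact: lt_le_trans uv.
have [xy|/le] := ltP (H x) (H y); last by rewrite leqNgt => /negbTE.
apply/proper_card/fintype.properP; split.
  by apply/fintype.subsetP => z; rewrite !inE => zx; apply: lt_trans zx xy.
by exists x; rewrite !inE ?ltxx.
Qed.

Lemma height_funV w : H w^-1%g = H w.
Proof. by rewrite /H bilC bil_actl invgK. Qed.

Lemma heightV w : h w^-1%g = h w.
Proof. by rewrite /h height_funV. Qed.

Lemma height_fun_s w i : H (w * s i)%g = H w + ev rho i * bil rho (act w (av i)).
Proof.
rewrite /H actM act_s_val [X in - bil _ X]linearB [X in - bil _ (_ - X)]linearZ /=.
by rewrite bilBr bilZr opprB addrC.
Qed.

Lemma height_s w i : i != ord0 -> (h w < h (w * s i)%g)%N = p w i.
Proof.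
move=> i0; rewrite height_lt height_fun_s ltrDl pmulr_rgt0 ?rho_regular //.
by rewrite ascentE.
Qed.

Lemma height_fun_left w j : j != ord0 -> (H w < H (s j * w)%g) = p w^-1%g j.
Proof.
move=> j0; rewrite -height_s // height_lt -[in RHS](height_funV (w^-1 * s j)).
by rewrite height_funV invMg invgK (sV sK).
Qed.

Lemma supported_ascent (J : {set I}) x eta j y :
  (forall i, i \in J -> p x i) -> posv eta -> (forall i, i \notin J -> eta 0 i = 0) ->
  act x (phi eta) = (dd j)^-1 *: act y (av j) -> p y j.
Proof.
move=> px pe eJ e; rewrite ascent_ge0.
have : 0 <= bil rho (act x (phi eta)).
  rewrite /phi linear_sum bil_sumr; apply: sumr_ge0 => i _; rewrite linearZ bilZr.
  have [iJ|/eJ ->] := boolP (i \in J); last by rewrite !mul0r.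
  apply: mulr_ge0; first by apply: divr_ge0; [exact: pe | exact/ltW/dd_gt0].
  by have := px i iJ; rewrite ascent_ge0.
by rewrite e bilZr pmulr_rge0 // invr_gt0 dd_gt0.
Qed.

Lemma supported_descent (J : {set I}) x eta j y :
  (forall i, i \in J -> ~~ p x i) -> posv eta -> (forall i, i \notin J -> eta 0 i = 0) ->
  act x (phi eta) = (dd j)^-1 *: act y (av j) -> ~~ p y j.
Proof.
move=> px pe eJ e; rewrite ascentE -leNgt.
have : bil rho (act x (phi eta)) <= 0.
  rewrite /phi linear_sum bil_sumr; apply: sumr_le0 => i _; rewrite linearZ bilZr.
  have [iJ|/eJ ->] := boolP (i \in J); last by rewrite !mul0r.
  apply: mulr_ge0_le0; first by apply: divr_ge0; [exact: pe | exact/ltW/dd_gt0].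
  by have := px i iJ; rewrite ascentE -leNgt.
by rewrite e bilZr pmulr_rle0 // invr_gt0 dd_gt0.
Qed.

Lemma reduced_step (J : {set I}) j l x :
  all (mem J) (j :: l) -> reduced (mem J) (j :: l) ->
  exists eta, [/\ posv eta, forall i, i \notin J -> eta 0 i = 0 &
    act x^-1%g (phi eta) = (dd j)^-1 *: act (sw l * x)^-1%g (av j)].
Proof.
move=> Jl red; exists (rw (rev l) (al j)); split.
- apply: (@reduced_pos (mem J)); first by rewrite -rev_cons all_rev.
  by rewrite -rev_cons; apply: reduced_rev.
- case/andP: Jl => Jj Jl i iJ; rewrite rw_coord.
    by rewrite mxE (negPf (_ : i != j)) //; apply: contraNneq iJ => ->.
  by rewrite mem_rev; apply: contra iJ => /(allP Jl).
- by rewrite phi_rw -actM phi_al linearZ invMg (sw_rev sK).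
Qed.

(** Prepend to x the letters of a reduced word of y one at a time; [reduced_step] and
    [supported_descent] show that each of them lowers the height. *)
Lemma height_top (J : {set I}) x y : ord0 \notin J ->
  (forall j, j \in J -> ~~ p x^-1%g j) -> in_parabolic s J y -> y != 1%g ->
  (h (y * x)%g < h x)%N.
Proof.
move=> J0 px [l0 Jl0 ->]; have [l [Jl red /sw_eq <-]] := exists_reduced Jl0.
rewrite height_lt; elim: l Jl red => [|j l IH] Jl red; first by rewrite sw_nil eqxx.
move=> _; have [eta [pe eJ e]] := reduced_step x Jl red.
have np := supported_descent px pe eJ e.
have j0 : j != ord0 by case/andP: Jl => Jj _; apply: contraNneq J0 => <-.
have lt : H (s j * (sw l * x))%g < H (sw l * x)%g.
  rewrite -{2}(mul1g (sw l * x)%g) -(sK j) -mulgA height_fun_left //.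
  by rewrite invMg (sV sK) ascent_s.
rewrite sw_cons -mulgA; apply: lt_le_trans lt _.
have [->|l1] := eqVneq (sw l) 1%g; first by rewrite mul1g.
apply/ltW/IH => //; first by case/andP: Jl.
by apply: (@reduced_catr _ [:: j]) red; case/andP: Jl => /= ->.
Qed.

Lemma height_bot (J : {set I}) x y : ord0 \notin J ->
  (forall j, j \in J -> p x^-1%g j) -> in_parabolic s J y -> y != 1%g ->
  (h x < h (y * x)%g)%N.
Proof.
move=> J0 px [l0 Jl0 ->]; have [l [Jl red /sw_eq <-]] := exists_reduced Jl0.
rewrite height_lt; elim: l Jl red => [|j l IH] Jl red; first by rewrite sw_nil eqxx.
move=> _; have [eta [pe eJ e]] := reduced_step x Jl red.
have pz := supported_ascent px pe eJ e.
have j0 : j != ord0 by case/andP: Jl => Jj _; apply: contraNneq J0 => <-.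
rewrite sw_cons -mulgA; apply: (@le_lt_trans _ _ (H (sw l * x)%g)); last first.
  by rewrite height_fun_left.
have [->|l1] := eqVneq (sw l) 1%g; first by rewrite mul1g.
apply/ltW/IH => //; first by case/andP: Jl.
by apply: (@reduced_catr _ [:: j]) red; case/andP: Jl => /= ->.
Qed.

(** Words in J preserve the coordinate at j, which $s_j$ negates on $\alpha_j$. *)
Lemma s_notin_parabolic (J : {set I}) j : ord0 \notin J -> j != ord0 -> j \notin J ->
  ~ in_parabolic s J (s j).
Proof.
move=> J0 j0 jJ [l Jl e].
have : rw l (al j) = - al j.
  apply: phi_inj0; first by rewrite phi_rw -e -phi_rr rr_al.
  rewrite rw_coord; last by apply: contra J0 => /(allP Jl).
  by rewrite !mxE eq_sym (negPf j0) oppr0.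
move/rowP/(_ j); rewrite rw_coord; last by apply: contra jJ => /(allP Jl).
rewrite !mxE !eqxx /= => /eqP; rewrite -addr_eq0 -mulr2n pnatr_eq0.
by [].
Qed.

(** Among the positive images of the coroot of [ord0], choose one whose product with rho is least.
    The simple reflection found by [reflection_descent] lowers this product, hence makes the vector
    negative, and [vpos_flip] applies. *)
Lemma alpha0_conj_simple : exists w i c,
  [/\ i != ord0, 0 < c & act w (av ord0) = c *: av i].
Proof.
have [w0 pw0] : exists w, p w ord0.
  have := ascent_s 1%g ord0; case: (boolP (p 1%g ord0)) => [p1 _|_ ps].
    by exists 1%g.
  by exists (1 * s ord0)%g.
have [w pw wmin] := @arg_minP _ _ _ w0 (p^~ ord0) (fun w => bil rho (act w (av ord0))) pw0.
have [i [c [xi [i0 ec vxi e]]]] := reflection_descent w ord0.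
have vsum := vposD (vpos_phi_al i0) vxi.
have c_gt0 : 0 < c.
  have := regular_vpos rho_regular vsum; rewrite -e bilZr pmulr_lgt0 //.
  by rewrite -ascentE.
have evi : 0 < ev (act w (av ord0)) i.
  move: c_gt0; rewrite ec pmulr_lgt0 ?invr_gt0 ?dd_gt0 //.
  by rewrite phi_al bilZr bil_av mulKf // dd_neq0.
have nps : ~~ p (s i * w)%g ord0.
  apply/negP => ps; have := wmin _ ps; rewrite actM act_s_val bilBr bilZr.
  by have := mulr_gt0 evi (regular_vpos rho_regular (vpos_av i0)); lra.
have vw : vpos (act w (av ord0)) by apply/asboolP; rewrite -ascent_vpos.
have [|] := coherent_av (s i * w)%g ord0.
  by move=> /asboolP; rewrite -ascent_vpos (negPf nps).
by rewrite actM => /(vpos_flip i0 vw)[d d0 ed]; exists w, i, d.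
Qed.

(** * Translations, retractions and transitivity *)

Hypothesis M_indec : indecomposable M.

Definition translation_by (tau : V) (l : seq I) : Prop :=
  sw l = 1%g /\ forall xi, rw l xi = xi + evx tau xi *: delta.

Definition translation (tau : V) : Prop := exists l, translation_by tau l.

Lemma evxDl x y xi : evx (x + y) xi = evx x xi + evx y xi.
Proof. by rewrite -!bil_phi bilDl. Qed.

Lemma translation_rev tau l xi : translation_by tau l ->
  rw (rev l) xi = xi - evx tau xi *: delta.
Proof.
move=> [_ lE]; apply: (can_inj (rwK l)); rewrite rwVK lE.
have -> : evx tau (xi - evx tau xi *: delta) = evx tau xi.
  by rewrite -scaleNr addrC evx_lin evx_delta mulr0 add0r.
by rewrite subrK.
Qed.

Lemma translation0 : translation 0.
Proof.
by exists [::]; split=> [|xi]; rewrite ?sw_nil // -bil_phi bil0l scale0r addr0.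
Qed.

Lemma translationD x y : translation x -> translation y -> translation (x + y).
Proof.
move=> [l [l1 lE]] [m [m1 mE]]; exists (l ++ m).
split=> [|xi]; first by rewrite sw_cat l1 m1 mulg1.
have e : evx x (xi + evx y xi *: delta) = evx x xi.
  by rewrite addrC evx_lin evx_delta mulr0 add0r.
rewrite rw_cat mE lE e evxDl scalerDl -addrA; congr (_ + _); exact: addrC.
Qed.

Lemma translationN x : translation x -> translation (- x).
Proof.
move=> [l lT]; exists (rev l); split=> [|xi].
  by rewrite (sw_rev sK) lT.1 invg1.
by rewrite (translation_rev _ lT) -!bil_phi bilNl scaleNr.
Qed.

Lemma translation_act w x : translation x -> translation (act w x).
Proof.
have [m _ ->] := in_parabolic_full w.
move=> [l [l1 lE]]; exists (m ++ l ++ rev m); split=> [|xi].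
  by rewrite !sw_cat l1 mul1g (sw_rev sK) mulgV.
rewrite !rw_cat lE addrC rw_lin rw_delta rwVK addrC; congr (_ + _ *: _).
by rewrite -!bil_phi phi_rw (sw_rev sK) bil_actl.
Qed.

Lemma translation_sum (T : eqType) (r : seq T) (P : pred T) (F : T -> V) :
  (forall t, t \in r -> P t -> translation (F t)) ->
  translation (\sum_(t <- r | P t) F t).
Proof.
move=> tF; rewrite big_seq_cond.
elim/big_ind: _ => //; [exact: translation0 | exact: translationD|].
by move=> t /andP[]; apply: tF.
Qed.

Lemma translation_coroot x i : translation x -> translation (ev x i *: av i).
Proof.
move=> tx; have -> : ev x i *: av i = x - act (s i) x.
  by rewrite act_s_val opprB addrC subrK.
by apply: translationD => //; apply/translationN/translation_act.
Qed.

(** Multiply $s_0$ by the inverse of a word in the finite nodes with the same image in the finite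
    group. The amount of translation is read on the coordinate at [ord0]. *)
Lemma translation_av0 : translation ((a ord0)%:R^-1 *: av ord0).
Proof.
have [m m0 em] := in_parabolic_full (s ord0).
have m0' : ord0 \notin rev m.
  by rewrite mem_rev; apply/negP => /(allP m0); rewrite /= !inE eqxx.
exists (ord0 :: rev m); split=> [|xi].
  by rewrite sw_cons (sw_rev sK) -em mulgV.
apply: phi_inj0.
  by rewrite phi_rw sw_cons (sw_rev sK) -em mulgV act1 id_lfunE linearD linearZ /=
    phi_delta scaler0 addr0.
have e : evx (av ord0) (rw (rev m) xi) = - evx (av ord0) xi.
  by rewrite -!bil_phi phi_rw (sw_rev sK) -em -bil_actl act_s_av bilNl.
rewrite [LHS]/= /rr e !mxE rw_coord // !eqxx -[evx (_ *: _) _]bil_phi bilZl bil_phi.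
have a0 := lt0r_neq0 (a_gt0 ord0).
by rewrite mulr1 opprK mulrAC mulVf // mul1r.
Qed.

(** The set of such nodes contains [ord0], and by [translation_coroot] it is closed under adjacency;
    indecomposability makes it everything. *)
Lemma translation_ev i : exists2 x, translation x & ev x i != 0.
Proof.
pose J := [set i | `[<exists2 x, translation x & ev x i != 0>]]%SET.
suff JT : J = [set: I]%SET.
  by have : i \in J by [rewrite JT inE]; rewrite inE => /asboolP.
apply/eqP/negPn/negP => JT.
have J0 : J != finset.set0.
  apply/finset.set0Pn; exists ord0; rewrite inE; apply/asboolP.
  exists ((a ord0)%:R^-1 *: av ord0); first exact: translation_av0.
  by rewrite evZ ev_av_diag mulf_neq0 ?invr_eq0 ?pnatr_eq0 // -(pnatr_eq0 R) gt_eqF ?a_gt0.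
have [j [k [+ kJ Mjk]]] := M_indec J0 JT.
rewrite inE => /asboolP[x tx xj]; move: kJ; rewrite inE => /asboolP; apply.
exists (ev x j *: av j); first exact: translation_coroot.
by rewrite evZ ev_av mulf_neq0 // intr_eq0.
Qed.

Lemma translation_av i : exists2 c, 0 < c & translation (c *: av i).
Proof.
have [x tx xi] := translation_ev i.
have [p|n0] := ltP 0 (ev x i); first by exists (ev x i) => //;
  apply: translation_coroot.
exists (- ev x i); first by rewrite oppr_gt0 lt_def eq_sym xi.
by rewrite scaleNr; apply/translationN/translation_coroot.
Qed.

(** The construction is that of rho, with each coroot rescaled to become a translation. *)
Lemma translation_regular : exists2 x, translation x & regular x.
Proof.
have ex i : exists c, 0 < c /\ translation (c *: av i).
  by have [c] := translation_av i; exists c.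
have [c cP] := boolp.choice ex.
pose S := undup [seq c i *: act w (av i) | w <- enum gT, i <- [seq j <- enum 'I_n.+1 | j != ord0]].
have SP v : v \in S -> exists w i, i != ord0 /\ v = c i *: act w (av i).
  rewrite mem_undup => /allpairsPdep[w [i [_ +]]].
  by rewrite mem_filter => /andP[i0 _] ->; exists w, i.
have memS w i : i != ord0 -> c i *: act w (av i) \in S.
  move=> i0; rewrite mem_undup; apply/allpairsPdep; exists w, i.
  by rewrite mem_enum mem_filter mem_enum i0.
exists (\sum_(v <- S | `[<vpos v>]) v).
  apply: translation_sum => v /SP[w [i [_ ->]]] _.
  have -> : c i *: act w (av i) = act w (c i *: av i) by rewrite linearZ.
  by apply: translation_act; have [] := cP i.
apply: regular_sum.
- exact: undup_uniq.
- by move=> j v j0 /SP[w [i [i0 ->]]]; rewrite linearZ /= -actM memS.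
- move=> v /SP[w [i [i0 ->]]]; apply: coherentZ; last exact: coherent_av.
  by have [c0 _] := cP i; rewrite gt_eqF.
- move=> j j0; have [c0 _] := cP j; exists (c j *: av j); last by exists (c j).
  by have := memS 1%g j j0; rewrite act1 id_lfunE.
Qed.

(** * Dominant translations with stabilizer $W_J$ *)

Section Face.
Variable J : {set I}.
Hypothesis J0 : ord0 \notin J.
Local Notation inW := (in_parabolic s J).

(** Sum a regular translation over $W_J$. For j outside J, each $y^{-1}\alpha_j$ has coordinate 1 at
    j, so it is positive and every term contributes nonnegatively; for j in J, invariance forces the
    value 0. *)
Lemma face_translation : exists x, [/\ translation x,
  forall y, inW y -> act y x = x, dominant x &
  forall j, j != ord0 -> j \notin J -> 0 < ev x j].
Proof.
have [x0 tx0 rx0] := translation_regular.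
pose x := \sum_(y | `[<inW y>]) act y x0.
have fix_x y : inW y -> act y x = x.
  move=> Wy; rewrite /x linear_sum [RHS](reindex_inj (mulgI y)) /=.
  apply: eq_big => z; last by rewrite actM.
  apply: asbool_equiv_eq; split; first exact: inWM.
  by move/(inWMl sK Wy).
have x_pos j : j != ord0 -> j \notin J -> 0 < ev x j.
  move=> j0 jJ; rewrite ev_sum (bigD1 1%g) /=; last by apply: asboolT; apply: inW1.
  rewrite act1 id_lfunE ltr_pwDl ?rx0 //; apply: sumr_ge0 => y /andP[/asboolP Wy _].
  have [l Jl ey] := inWV sK Wy.
  have -> : ev (act y x0) j = bil x0 (phi (rw l (al j))).
    by rewrite phi_rw -ey -bil_actl bil_phi evx_al.
  apply: dominant_vpos; first by move=> k /rx0/ltW.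
  have rj : rw l (al j) 0 j = 1.
    by rewrite rw_coord ?mxE ?eqxx //; apply: contra jJ => /(allP Jl).
  have rr := root_rw l (root_al j).
  have r0 : rw l (al j) 0 ord0 = 0.
    rewrite rw_coord; last by apply: contra J0 => /(allP Jl).
    by rewrite mxE eq_sym (negPf j0).
  have [//|[xi [px xi0 _ exi]]] := root_coherent rr r0.
  exfalso; have e : xi = - rw l (al j).
    by apply: phi_inj0; rewrite ?linearN // mxE r0 xi0 oppr0.
  by have := px j; rewrite e mxE rj oppr_ge0 leNgt ltr01.
exists x; split=> //.
  by apply: translation_sum => y _ _; apply: translation_act.
move=> j j0; have [jJ|/(x_pos _ j0)/ltW //] := boolP (j \in J).
have := fix_x _ (inWs s jJ); rewrite act_s_val => /eqP.
rewrite -subr_eq0 addrC addKr oppr_eq0 scaler_eq0 (negPf (av_neq0 j)) orbF.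
by move=> /eqP ->.
Qed.

Variable x : V.
Hypothesis x_fix : forall y, inW y -> act y x = x.
Hypothesis x_dom : dominant x.
Hypothesis x_pos : forall j, j != ord0 -> j \notin J -> 0 < ev x j.

(** At a descent i of w, dominance of x and of $w x$ forces x to vanish on $\alpha_i$; so i is in J
    and $w s_i$ is lower. *)
Lemma dominant_orbit w : dominant (act w x) -> inW w.
Proof.
elim: {w}(height w).+1 {-2}w (ltnSn (height w)) => // m IH w hw dw.
have [->|/exists_descent[i i0 vi]] := eqVneq w 1%g; first exact: inW1.
have xi0 : ev x i = 0.
  apply/eqP; rewrite eq_le x_dom // andbT -evx_al -bil_phi -oppr_ge0 -(bil_act w) -bilNr.
  exact: dominant_vpos.
have Ji : i \in J by apply/negPn/negP => /(x_pos i0); rewrite xi0 ltxx.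
rewrite -(mulgK (s i) w) (sV sK); apply: inWM (inWs s Ji).
apply: IH; last by rewrite actM act_s_val xi0 scale0r subr0.
rewrite -ltnS; apply: leq_trans hw; rewrite ltnS.
rewrite -{2}(mulg1 w) -(sK i) mulgA height_s // ascent_s ascent_vpos.
apply/asboolP => v; apply: (vpos_anti v).
by rewrite av_phi linearZ -scalerN; apply: vposZ (dd_gt0 i) vi.
Qed.

Lemma face_ascent y w i : inW y -> 0 < bil x (act w (av i)) -> ascent (y * w)%g i.
Proof.
move=> Wy xw; rewrite ascent_vpos; apply/asboolP.
have [//|/(dominant_vpos x_dom)] := coherent_av (y * w)%g i.
by rewrite bilNr oppr_ge0 actM -{1}(x_fix Wy) bil_act leNgt xw.
Qed.

Lemma root_opp xi : is_root xi -> is_root (- xi).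
Proof.
move=> [k [m [xk N0 xm]]]; exists (fun i => - k i), (fun i => - m i).
have e : qf (- xi) = qf xi by rewrite /qf linearN bilNl bilNr opprK.
by rewrite e; split=> // i; rewrite mxE rmorphN /= ?xk // !mulNr -xm xk.
Qed.

Local Notation fold := (fold_word s ascent).

Lemma fold_rcons y u k : fold y (rcons u k) = fold_step s ascent (fold y u) k.
Proof. exact: foldl_rcons. Qed.

Section ReducedTranslation.
Variable l : seq I.
Hypothesis l_transl : translation_by x l.
Hypothesis l_red : reduced predT l.

(** Reducedness makes both $u\alpha_k$ and $v^{-1}\alpha_k$ positive, and the inverse translation
    sends the former to minus the latter. It subtracts a multiple of delta, whose coefficient must
    therefore be positive. *)
Lemma translation_cross u k v : l = u ++ k :: v -> 0 < bil x (act (sw u) (av k)).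
Proof.
move=> el; have red1 : reduced predT (rcons u k).
  by apply: (@reduced_catl _ _ v) => //; rewrite ?all_predT // cat_rcons -el.
have red2 : reduced predT (rcons (rev v) k).
  rewrite -rev_cons; apply: reduced_rev; apply: (@reduced_catr _ u);
    rewrite ?all_predT //.
  by rewrite -el.
have pu := reduced_pos (all_predT _) red1;
  have pv := reduced_pos (all_predT _) red2.
have e : - rw (rev v) (al k) = rw u (al k) - evx x (rw u (al k)) *: delta.
  rewrite -(translation_rev _ l_transl) el rev_cat rw_cat rwK rev_cons -cats1 rw_cat /=.
  by rewrite rr_al rwN.
have e2 : evx x (rw u (al k)) = bil x (act (sw u) (av k)) / dd k.
  by rewrite -bil_phi phi_rw phi_al linearZ bilZr mulrC.
suff : 0 < evx x (rw u (al k)) by rewrite e2 pmulr_lgt0 // invr_gt0 dd_gt0.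
rewrite ltNge; apply/negP => le0.
case/negP: (root_neq0 (root_rw u (root_al k))); apply/eqP/rowP => i;
  rewrite [RHS]mxE.
apply/eqP; rewrite eq_le pu andbT.
have /rowP/(_ i) := e; rewrite !mxE => ei.
have := pv i; have : evx x (rw u (al k)) * (a i)%:R <= 0.
  by rewrite pmulr_lle0 // a_gt0.
by move: ei; lra.
Qed.

(** By [translation_cross] and [face_ascent] no letter is blocked, and l is trivial in the finite
    group. *)
Lemma translation_fold_fix y : inW y -> fold y l = y.
Proof.
move=> Wy; suff H u v : l = u ++ v -> fold y u = (y * sw u)%g.
  by rewrite (H l [::]) ?cats0 // l_transl.1 mulg1.
elim/last_ind: u v => [|u k IH] v; first by rewrite sw_nil mulg1.
rewrite cat_rcons => el; rewrite fold_rcons (IH _ el) /fold_step face_ascent //;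
  last exact: translation_cross el.
by rewrite -cats1 sw_cat sw_cons sw_nil mulg1 mulgA.
Qed.

(* Compare the walk [fold w u] with the walk [sw u], which always ascends: their
   relative position [z u] changes only when the former is blocked, and is then
   multiplied by a reflection that lowers it.  If it never changes, then [w x]
   is dominant, because a translation crosses walls in every direction that is
   not orthogonal to it. *)
Lemma translation_fold_lt w : ~ inW w -> (height (fold w l) < height w)%N.
Proof.
move=> nWw; rewrite height_lt.
pose z u := (fold w u * (sw u)^-1)%g.
suff H u v : l = u ++ v -> height_fun (z u) < height_fun w \/
    (z u = w /\ forall u1 k u2, u = u1 ++ k :: u2 -> ascent (w * sw u1)%g k).
  have [|[_ asc]] := H l [::] (esym (cats0 l)).
    by rewrite /z l_transl.1 invg1 mulg1.
  case: nWw; apply: dominant_orbit => j j0; rewrite leNgt; apply/negP => neg.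
  have [xi [rxi xi0 exi]] := finite_root w^-1%g j0.
  have rg := root_opp rxi; have xg : 0 < evx x (- xi).
    by rewrite -bil_phi linearN /= exi bilNr -bil_actl bil_phi evx_al oppr_gt0.
  have pg : posv (- xi).
    have g0 : (- xi) 0 ord0 = 0 by rewrite mxE xi0 oppr0.
    have [//|ng] := root_sign rg; exfalso.
    have : 0 <= bil x (phi (- - xi)).
      rewrite bil_phi; apply: sumr_ge0 => i _; have [->|i0] := eqVneq i ord0.
        by rewrite opprK xi0 mul0r.
      by rewrite mulr_ge0 ?ng ?x_dom.
    by rewrite linearN bilNr bil_phi oppr_ge0 leNgt xg.
  (* The inverse translation gives the root [- xi] a negative coordinate at [ord0]. *)
  have ng : posv (- rw (rev l) (- xi)).
    have [p|//] := root_sign (root_rw (rev l) rg); exfalso.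
    have := p ord0;
      rewrite (translation_rev _ l_transl) !mxE xi0 oppr0 sub0r oppr_ge0 leNgt.
    by rewrite mulr_gt0 ?a_gt0.
  have [l1 [k [l2 [c [el c0 e]]]]] := neg_split rg pg ng.
  (* At this letter k the ascent would concern a positive multiple of [- phi (al j)], which is
     negative. *)
  have el' : l = rev l2 ++ k :: rev l1 by rewrite -(revK l) el rev_cat rev_cons cat_rcons.
  have := asc _ _ _ el'; rewrite ascent_vpos => /asboolP.
  have -> : act (w * sw (rev l2))%g (av k) = (c^-1 * dd k) *: - phi (al j).
    have -> : av k = (c^-1 * dd k) *: (c *: phi (al k)).
      by rewrite scalerA mulrAC mulVf ?mul1r ?av_phi // gt_eqF.
    have -> : c *: phi (al k) = phi (rw l2 (- xi)) by rewrite e linearZ.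
    rewrite linearZ /= actM -phi_rw rwK linearN /= exi; congr (_ *: _).
    by rewrite linearN /= actKV.
  move=> v; apply: (vpos_anti (vpos_phi_al j0)).
  have := vposZ _ v; move=> /(_ (c^-1 * dd k)^-1); rewrite scalerA mulVf ?scale1r.
    by apply; rewrite invr_gt0 mulr_gt0 ?invr_gt0 ?dd_gt0.
  by rewrite mulf_neq0 ?invr_eq0 ?dd_neq0 // gt_eqF.
elim/last_ind: u v => [|u k IH] v.
  by move=> _; right; rewrite /z sw_nil invg1 mulg1; split=> // -[].
rewrite cat_rcons => el.
have zr : z (rcons u k) = (fold_step s ascent (fold w u) k * s k * (sw u)^-1)%g.
  by rewrite /z fold_rcons -cats1 sw_cat sw_cons sw_nil mulg1 invMg (sV sK) mulgA.
have fw : fold w u = (z u * sw u)%g by rewrite /z mulgKV.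
case pk: (ascent (fold w u) k).
  have zu : z (rcons u k) = z u by rewrite zr /fold_step pk -[(_ * s k * s k)%g]mulgA sK mulg1.
  rewrite zu; case: (IH _ el) => [|[zw asc]]; [by left|right; split=> // u1 j u2].
  case/lastP: u2 => [|u2 j'].
    by rewrite cats1 => /rcons_inj[<- <-]; rewrite -zw -fw.
  by rewrite -rcons_cons -rcons_cat => /rcons_inj[+ _]; apply: asc.
left; have lt : height_fun (z (rcons u k)) < height_fun (z u).
  have zs : z (rcons u k) = (z u * (sw u * s k * (sw u)^-1))%g.
    by rewrite zr /fold_step pk fw !mulgA.
  rewrite zs /height_fun actM act_conj_s [X in - bil _ X < _]linearB.
  rewrite [X in - bil _ (_ - X) < _]linearZ /= -actM -fw bilBr bilZr opprB.
  rewrite gtrDr pmulr_rlt0; first by rewrite ltNge -ascent_ge0 pk.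
  rewrite divr_gt0 ?dd_gt0 // bilC -ascentE -[sw u]mul1g.
  by apply: face_ascent (inW1 s J) _; apply: translation_cross el.
by case: (IH _ el) => [|[<- _] //]; apply: lt_trans.
Qed.

End ReducedTranslation.

(** Each pass along a reduced word of the translation lowers the height outside $W_J$, so more
    passes than the greatest height suffice. *)
Lemma exists_retraction : translation x -> exists l,
  (forall w, inW (fold w l)) /\ (forall y, inW y -> fold y l = y).
Proof.
move=> [l0 [l0_1 l0E]]; have [l [_ red el]] := exists_reduced (all_predT l0).
have lT : translation_by x l by split=> [|xi]; [rewrite (sw_eq el) | rewrite el].
pose L N := flatten (nseq N l).
have foldL N w : fold w (L N.+1) = fold (fold w l) (L N) by exact: foldl_cat.
have fixL N y : inW y -> fold y (L N) = y.
  by move=> Wy; elim: N => // N IH; rewrite foldL (translation_fold_fix lT red Wy).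
have H N w : (height w < N)%N -> inW (fold w (L N)).
  elim: N w => // N IH w; rewrite ltnS => hw; rewrite foldL.
  case: (pselect (inW w)) => Ww;
    first by rewrite (translation_fold_fix lT red Ww) fixL.
  apply: IH; exact: leq_trans (translation_fold_lt lT red Ww) hw.
exists (L (\max_w height w).+1); split=> [w|y]; last exact: fixL.
by apply: H; rewrite ltnS leq_bigmax.
Qed.

(* The weights [a i * <w^-1 x, alpha_i>] form a circulation on the graph of
   right multiplications by the s_i, because delta vanishes on h^0.  Hence a
   set closed under the edges of positive weight is also closed backwards. *)
Lemma circulation_closed (X : {set gT}) :
  (forall w i, w \in X -> 0 < bil x (act w (av i)) -> (w * s i)%g \in X) ->
  forall w i, w \in X -> (w * s i)%g \notin X -> bil x (act w (av i)) = 0.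
Proof.
move=> Xpos; pose f i w : R := (a i)%:R * ev (act w^-1%g x) i.
have fE i w : f i w = (a i)%:R / dd i * bil x (act w (av i)).
  have -> : bil x (act w (av i)) = dd i * ev (act w^-1%g x) i.
    by rewrite bilC bil_actl bilC bil_av.
  by rewrite /f; field; rewrite dd_neq0.
have fk i : 0 < (a i)%:R / dd i :> R by rewrite divr_gt0 ?a_gt0 ?dd_gt0.
have f_s i w : f i (w * s i)%g = - f i w.
  by rewrite !fE actM act_s_av linearN bilNr mulrN.
pose g i := \sum_(w in X | (w * s i)%g \notin X) - f i w.
have g_ge0 i w : w \in X -> (w * s i)%g \notin X -> 0 <= - f i w.
  move=> wX wsX; rewrite oppr_ge0 fE pmulr_rle0 // leNgt.
  by apply: contra wsX; apply: Xpos.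
have inner i : \sum_(w in X | (w * s i)%g \in X) f i w = 0.
  set S := \sum_(w in X | _) _; suff : S = - S by move/eqP;
    rewrite eq_sym eqNr => /eqP.
  rewrite {1}/S (reindex_inj (mulIg (s i))) -sumrN; apply: eq_big => [w|w _];
    last first.
    by rewrite f_s.
  by rewrite -mulgA sK mulg1 andbC.
have gE : \sum_i g i = 0.
  apply/eqP; rewrite -oppr_eq0 -sumrN; apply/eqP.
  rewrite -[RHS](_ : \sum_(w in X) \sum_i f i w = 0); last first.
    by apply: big1 => w _; apply: ev_null.
  rewrite exchange_big; apply: eq_bigr => i _.
  rewrite [RHS](bigID (fun w => (w * s i)%g \in X)) /= inner add0r /g -sumrN.
  by apply: eq_bigr => w _; rewrite opprK.
have gi_ge0 j : 0 <= g j by apply: sumr_ge0 => u /andP[]; apply: g_ge0.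
move=> w i wX wsX; have gi0 : g i = 0 by apply: (psumr_eq0P (P := predT) _ gE).
have : - f i w = 0.
  by apply: (psumr_eq0P _ gi0) => [u /andP[]|]; [apply: g_ge0 | rewrite wX].
by move/eqP; rewrite oppr_eq0 fE mulf_eq0 (gt_eqF (fk i)) => /eqP.
Qed.

(** The set X of positions reached in parallel from $W_J w$ is closed under moves of positive
    weight. By [circulation_closed] a move leaving X has weight zero; its reflection then fixes x,
    so the move stays in the same coset of $W_J$. Hence X meets every coset. *)
Lemma parabolic_transit w u : exists l y0, inW y0 /\
  forall y, inW y -> fold (y * w)%g l = (y * (y0 * u))%g.
Proof.
pose X := [set z | `[<exists l, forall y, inW y -> fold (y * w)%g l = (y * z)%g>]]%SET.
have Xpos z i : z \in X -> 0 < bil x (act z (av i)) -> (z * s i)%g \in X.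
  rewrite inE => /asboolP[l lE] zi; rewrite inE; apply/asboolP;
    exists (rcons l i) => y Wy.
  by rewrite fold_rcons lE // /fold_step face_ascent // mulgA.
have Xzero := circulation_closed Xpos.
suff [y0 Wy0] : exists2 y0, inW y0 & (y0 * u)%g \in X.
  by rewrite inE => /asboolP[l lE]; exists l, y0.
have [m _ em] := in_parabolic_full (w^-1 * u)%g.
have -> : u = (w * sw m)%g by rewrite -em mulKVg.
elim/last_ind: {em}m => [|m i [y0 Wy0 Xy]].
  exists 1%g; first exact: inW1.
  by rewrite sw_nil mulg1 mul1g inE; apply/asboolP; exists [::].
rewrite -cats1 sw_cat sw_cons sw_nil mulg1.
have [Xys|nXys] := boolP ((y0 * (w * sw m) * s i)%g \in X).
  by exists y0; rewrite // !mulgA in Xys *.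
set z := (y0 * (w * sw m))%g in Xy nXys.
have Wr : inW (z * s i * z^-1)%g.
  apply: dominant_orbit; rewrite act_conj_s bilC (Xzero _ _ Xy nXys).
  by rewrite mul0r scale0r subr0.
exists ((z * s i * z^-1)^-1 * y0)%g; first by apply: inWM Wy0; apply: (inWV sK Wr).
suff -> : ((z * s i * z^-1)^-1 * y0 * (w * (sw m * s i)) = z)%g by [].
by apply: (mulgI (z * s i * z^-1)%g);
  rewrite mulgKV -(mulgA (z * s i * z^-1)^-1%g) mulKVg /z !mulgA.
Qed.

End Face.

(** * The sign character and generation *)

(* [act w] extended to h by the identity on the complement of h^0 along which
   [vsproj] projects, so as to be a matrix. *)
Definition ext (w : gT) : 'End('rV[R]_n.+1) :=
  (\1 + (linfun vsval \o (act w - \1) \o linfun (vsproj (h0 R a))))%VF.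

Lemma extE w v :
  ext w v = v + vsval (act w (vsproj (h0 R a) v) - vsproj (h0 R a) v).
Proof.
by rewrite /ext add_lfunE id_lfunE !comp_lfunE add_lfunE opp_lfunE id_lfunE
  !(lfunE vsval) !(lfunE (vsproj _)).
Qed.

Lemma extM u w v : ext (u * w)%g v = ext u (ext w v).
Proof.
have e : vsproj (h0 R a) (ext w v) = act w (vsproj (h0 R a) v).
  by rewrite extE [LHS]linearD [X in _ + X]vsvalK addrC subrK.
rewrite [LHS]extE [RHS]extE e [ext w v]extE actM -addrA; congr (_ + _).
have split3 (y z t : V) : y - t = (z - t) + (y - z).
  by rewrite [RHS]addrC addrA subrK.
by rewrite [X in vsval X = _](split3 _ (act w (vsproj (h0 R a) v))) linearD.
Qed.

(** The sign character of the finite Weyl group. *)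
Definition det_act (w : gT) : R[i] := (\det (lin1_mx (ext w)))%:C%C.

Lemma det_actM u w : det_act (u * w)%g = det_act u * det_act w.
Proof.
rewrite /det_act -rmorphM mulrC -det_mulmx; congr (\det _)%:C%C.
apply/row_matrixP => i; rewrite !rowE mulmxA !mul_rV_lin1.
exact: extM.
Qed.

Lemma det_act_s i : det_act (s i) = -1.
Proof.
pose u : 'cV[R]_n.+1 := \col_k ev (vsproj (h0 R a) (delta_mx 0 k)) i.
have -> : -1 = (- 1 : R)%:C%C by rewrite rmorphN1.
congr (_%:C%C); have -> : lin1_mx (ext (s i)) = 1%:M - u *m alphav R M i.
  apply/row_matrixP => k;
    rewrite !rowE mul_rV_lin1 [LHS]extE act_s_val [X in vsval X]addrAC subrr add0r.
  have e c : vsval (- (c *: av i)) = - (c *: alphav R M i).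
    by rewrite -scaleNr [LHS]linearZ /= vsval_av scaleNr.
  rewrite e mulmxBr mulmx1 mulmxA -rowE; congr (_ + - _).
  by apply/rowP => j; rewrite mxE [RHS]mxE big_ord1 !mxE.
rewrite det_rank1.
have -> : (alphav R M i *m u) 0 0 = ev (av i) i.
  rewrite mxE [in RHS]/cl_alphav [in RHS](row_sum_delta (alphav R M i)) linear_sum ev_sum.
  by apply: eq_bigr => k _; rewrite linearZ [RHS]evZ [X in _ * X]mxE.
by rewrite ev_av_diag; ring.
Qed.

Lemma nondegenerate u v : (forall x, bil x u = bil x v) -> u = v.
Proof.
move=> e; apply/eqP; rewrite -subr_eq0; apply/negPn/negP => /bil_gt0.
by rewrite bilBr e subrr ltxx.
Qed.

Lemma maps_alpha0P Omega : maps_alpha0_to_simple act Omega ->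
  exists i c, [/\ i != ord0, 0 < c & act Omega (av ord0) = c *: av i].
Proof.
move=> [i [c [i0 c0 e]]]; exists i, (c * dd ord0 / dd i); split=> //.
  by apply: divr_gt0; [apply: mulr_gt0 c0 _|]; exact: dd_gt0.
apply: nondegenerate => x; rewrite bilC bil_actl bilC bil_av bilZr bil_av.
have := congr1 (fun f : 'Hom(V, R^o) => f x) e.
rewrite /dual_act comp_lfunE scale_lfunE !cl_dualE -!/(ev _ _) => ->.
by rewrite /GRing.scale /=; field; rewrite dd_neq0.
Qed.

(** Right multiplication by $\Omega^{-1}$ carries the edges labelled [ord0] to those labelled i and
    preserves ascents, because $s_i\Omega = \Omega s_0$ and c is positive. *)
Lemma pi_op0_conj Omega i c : 0 < c -> act Omega (av ord0) = c *: av i ->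
  pi_op M act s ord0 =
    (rmulop R Omega \o (pi_op M act s i \o rmulop R Omega^-1%g))%VF.
Proof.
move=> c0 e; pose f w := if ascent w i then (w * s i)%g else w.
apply: etrans (etrans (basis_op_comp R (mulg^~ Omega) (f \o mulg^~ Omega^-1%g))
  (congr1 (comp_lfun (rmulop R Omega)) (basis_op_comp R f (mulg^~ Omega^-1%g)))).
apply: eq_basis_op => w; rewrite /= /f -/(ev _ _) -/(ascent _ _).
have -> : ascent (w * Omega^-1)%g i = ascent w ord0.
  rewrite !ascentE actM -[av i]scale1r -(mulVf (lt0r_neq0 c0)) -scalerA -e.
  by rewrite linearZ /= actK linearZ /= bilZr pmulr_rgt0 // invr_gt0.
case: ifP => _; last by rewrite mulgKV.
by rewrite -[RHS]mulgA (conj_s e) [RHS]mulgA mulgKV.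
Qed.

(** * Generation of the Hecke group algebra *)

Local Notation HW := (Hecke_group_algebra M act s).

Lemma Hecke_rmulop u : HW (rmulop R u).
Proof.
have [l l0 ->] := in_parabolic_full u; apply: alg_gen_rmulop_prod l0 => i.
by rewrite /= !inE => i0; apply: sub_alg_gen; right; exists i.
Qed.

Lemma Hecke_pi_op i : HW (pi_op M act s i).
Proof.
have [->|i0] := eqVneq i ord0; last by apply: sub_alg_gen; left; exists i.
have [w [j [c [j0 c0 e]]]] := alpha0_conj_simple.
rewrite (pi_op0_conj c0 e); apply: alg_genM; first exact: Hecke_rmulop.
apply: alg_genM; last exact: Hecke_rmulop.
by apply: sub_alg_gen; left; exists j.
Qed.

(** Right multiplications commute with left ones, so they preserve left antisymmetries and the
    abstract criterion applies. *)
Lemma rmulop_pi_op u : alg_gen (range (pi_op M act s)) (rmulop R u).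
Proof.
apply: (alg_of_preserves_antisym (p := ascent) sK ascent_s ascent_left det_actM det_act_s
  height_s heightV height_top height_bot in_parabolic_full s_notin_parabolic).
- move=> J J0; have [x [tx x_fix x_dom x_pos]] := face_translation J0.
  exact: exists_retraction x_pos tx.
- move=> J w v J0; have [x [tx x_fix x_dom x_pos]] := face_translation J0.
  exact: parabolic_transit x_pos w v.
- move=> J v J0; apply: antisym_basis_op => //; first exact: sK.
  exact: left_folding_mulr.
Qed.

Lemma alg_gen_pi_op : alg_gen (range (pi_op M act s)) = HW.
Proof.
apply/seteqP; split; apply: alg_gen_min; try exact: alg_gen_unital.
  by move=> _ [i _ <-]; apply: Hecke_pi_op.
move=> _ [[i _ <-]|[i _ <-]]; last exact: rmulop_pi_op.
by apply: sub_alg_gen; exists i.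
Qed.

Lemma alg_gen_rmulop Omega : maps_alpha0_to_simple act Omega ->
  alg_gen (pi_op M act s @` [set i | i != ord0] `|` [set rmulop R Omega]) = HW.
Proof.
move=> /maps_alpha0P[i [c [i0 c0 e]]].
apply/seteqP; split; last rewrite -alg_gen_pi_op; apply: alg_gen_min;
  try exact: alg_gen_unital.
  by move=> _ [[j _ <-]| ->]; [apply: Hecke_pi_op | apply: Hecke_rmulop].
set S := (X in alg_gen X).
have SO : alg_gen S (rmulop R Omega) by apply: sub_alg_gen; right.
have Spi j : j != ord0 -> alg_gen S (pi_op M act s j).
  by move=> j0; apply: sub_alg_gen; left; exists j.
move=> _ [j _ <-]; have [->|/Spi //] := eqVneq j ord0.
rewrite (pi_op0_conj c0 e); apply: alg_genM => //; apply: alg_genM;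
  first exact: Spi.
exact: alg_gen_rmulopV.
Qed.

End RootSystem.

Theorem corollary6p2 (R : realType) (n : nat) (M : 'M[int]_n.+1)
    (a : 'I_n.+1 -> nat) (gT : finGroupType)
    (act : gT -> 'End(subvs_of (h0 R a))) (s : 'I_n.+1 -> gT)
    (n_gt0 : (0 < n)%N)
    (M_gcm : is_gcm M) (M_indec : indecomposable M) (M_aff : affine_type M R)
    (a_null : null_root_coefs M a)
    (labelling : good_labelling R M a)
    (Wfin : is_finite_Weyl M act s) :
  alg_gen (range (pi_op M act s)) = Hecke_group_algebra M act s
  /\
  forall Omega : gT, maps_alpha0_to_simple act Omega ->
    alg_gen (pi_op M act s @` [set i | i != ord0] `|` [set rmulop R Omega])
    = Hecke_group_algebra M act s.
Proof.
split=> [|Omega]; first exact: alg_gen_pi_op.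
exact: alg_gen_rmulop.
Qed.
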